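(* Let $\theta=(\theta_t)_{t\in\mathbb R}$ be a smooth family of $1$-forms with $\theta_{t+1}=\theta_t$ on an open set $\mathfrak Q\subset\mathbb C$ containing $0$, and let $\Theta$ be the associated non-local magnetic $1$-form on $\bar{\mathcal L}^\times\mathfrak Z$ (see context). Let $\Lambda$ be the canonical $1$-form on $T^*\bar{\mathcal L}^\times\mathfrak Z$ and $\pi\colon T^*\bar{\mathcal L}^\times\mathfrak Z\to\bar{\mathcal L}^\times\mathfrak Z$ the base point projection. Then the $2$-forms $$\Omega:=d\Lambda\qquad\text{and}\qquad\Omega_\Theta:=\Omega+\pi^*d\Theta=d(\Lambda+\pi^*\Theta)$$ are weak symplectic forms on $T^*\bar{\mathcal L}^\times\mathfrak Z$.
   Context: Identify $\mathbb C\cong\mathbb R^2$; $\|\cdot\|$, $\langle\cdot,\cdot\rangle$ are the $L^2([0,1],\mathbb R^2)$ norm and inner product. $\varsigma(z)=z^2$, $\mathfrak Z:=\varsigma^{-1}(\mathfrak Q)$, $\vartheta_t=\varsigma^*\theta_t$. Loop space: $\mathcal L_\pm\mathfrak Z=\{z\in C^\infty(\mathbb R,\mathfrak Z):z(\tau+1)=\pm z(\tau)\}$, $\mathcal L_\pm^\times\mathfrak Z=\mathcal L_\pm\mathfrak Z\setminus\{0\}$, $\mathcal L_\pm\mathbb C$ likewise with target $\mathbb C$; $\bar{\mathcal L}^\times\mathfrak Z$ is the quotient of $\mathcal L^\times_+\mathfrak Z\cup\mathcal L^\times_-\mathfrak Z$ by the free involution $z\mapsto-z$; tangent vectors at a representative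 $z\in\mathcal L_\pm^\times\mathfrak Z$ are $\xi\in\mathcal L_\pm\mathbb C$. $T^*\bar{\mathcal L}^\times\mathfrak Z$ is the quotient of $(\mathcal L_+^\times\mathfrak Z\times\mathcal L_+\mathbb C)\cup(\mathcal L_-^\times\mathfrak Z\times\mathcal L_-\mathbb C)$ by $(z,\eta)\mapsto-(z,\eta)$, with $\pi(z,\eta)=z$; tangent vectors at $(z,\eta)$ are pairs $(\hat z,\hat\eta)\in\mathcal L_\pm\mathbb C\times\mathcal L_\pm\mathbb C$. All forms below are invariant under the sign involution and hence defined on the quotients. $\Lambda_{(z,\eta)}(\hat z,\hat\eta)=\langle\eta,\hat z\rangle$. With $t_z(\tau)=\|z\|^{-2}\int_0^\tau|z_s|^2ds$, $\Theta_z\xi=\int_0^1\vartheta_{t_z(\tau)}|_{z_\tau}\xi_\tau\,d\tau$. The exterior derivative of a $1$-form is $d\lambda(X,Y)=d(\lambda Y)X-d(\lambda X)Y-\lambda[X,Y]$ (and the usual formula for $2$-forms). A weak symplectic form is a closed $2$-form such that for every nonzero tangent vector there is another tangent vector at the same point on which the form pairs with it to a nonzero value. *)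

(* Defs.v *)
From Stdlib Require Import Reals Lra Lia Bool FunctionalExtensionality ProofIrrelevance.
From Coquelicot Require Import Coquelicot.
Open Scope R_scope.

(** * Calculus on real topological vector spaces *)

(** Coquelicot's [NormedModuleAux] is a module together with a uniform
    structure; unlike [NormedModule] it does not require a norm, so it also
    hosts Fréchet spaces such as spaces of smooth loops. *)
Notation tvs := (NormedModuleAux R_AbsRing).

Definition Rtvs : tvs := R_NormedModuleAux.

Definition prodtvs (E F : tvs) : tvs := prod_NormedModuleAux R_AbsRing E F.

(** [C] as a real topological vector space. *)
Definition Ctvs : tvs := prodtvs Rtvs Rtvs.

(** [l] is the derivative of [f] at [x] in the direction [v]. *)
Definition is_dderive (E F : tvs) (f : E -> F) (x v : E) (l : F) : Prop :=
  filterlim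
    (fun h : R_AbsRing => scal (/ h) (minus (f (plus x (scal h v))) (f x)))
    (locally' 0) (locally l).

(** [C^n] maps in the sense of Michal, Bastiani and Hamilton: the differential
    [U * E -> F] exists and is a [C^(n-1)] map of both arguments jointly.
    [f] is total, but only its values on the open set [U] matter. *)
Fixpoint Cn_on (n : nat) (E F : tvs) (U : E -> Prop) (f : E -> F) : Prop :=
  (forall x, U x -> continuous f x) /\
  match n with
  | O => True
  | S m => exists df : prodtvs E E -> F,
      (forall x v, U x -> is_dderive E F f x v (df (x, v))) /\
      Cn_on m (prodtvs E E) F (fun p => U (fst p)) df
  end.

Definition smooth_on (E F : tvs) (U : E -> Prop) (f : E -> F) : Prop :=
  forall n, Cn_on n E F U f.

Definition linear_form (E : tvs) (f : E -> R) : Prop :=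
  forall (a : R) (x y : E), f (plus (scal a x) y) = a * f x + f y.

(** [c] is the Lie bracket [[X,Y] = DY.X - DX.Y] at [x]. *)
Definition is_bracket (E : tvs) (X Y : E -> E) (x c : E) : Prop :=
  exists u w : E,
    is_dderive E E Y x (X x) u /\ is_dderive E E X x (Y x) w /\ c = minus u w.

(** Local vector fields on [U], defined near the point [x]. *)
Definition vector_field_near (E : tvs) (U V : E -> Prop) (x : E) (X : E -> E)
  : Prop :=
  open V /\ V x /\ (forall y, V y -> U y) /\ smooth_on E E V X.

(** * Differential forms on a quotient by the sign involution

    [E true], [E false] are two vector spaces and [U true], [U false] open
    subsets of them, symmetric under [x |-> -x].  A differential form on the
    quotient of the disjoint union of [U true] and [U false] by the free
    involution [x |-> -x] is a form on the disjoint union which is invariant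
    under the involution. *)

Definition one_form (E : bool -> tvs) := forall s, E s -> E s -> R.
Definition two_form (E : bool -> tvs) := forall s, E s -> E s -> E s -> R.

Definition is_one_form (E : bool -> tvs) (U : forall s, E s -> Prop)
    (lam : one_form E) : Prop :=
  forall s,
    (forall x, U s x -> linear_form (E s) (lam s x)) /\
    smooth_on (prodtvs (E s) (E s)) Rtvs (fun p => U s (fst p))
      (fun p => lam s (fst p) (snd p)) /\
    (forall x X, U s x -> lam s (opp x) (opp X) = lam s x X).

Definition is_two_form (E : bool -> tvs) (U : forall s, E s -> Prop)
    (om : two_form E) : Prop :=
  forall s,
    (forall x Y, U s x -> linear_form (E s) (fun X => om s x X Y)) /\
    (forall x X, U s x -> linear_form (E s) (om s x X)) /\
    (forall x X, U s x -> om s x X X = 0) /\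
    smooth_on (prodtvs (E s) (prodtvs (E s) (E s))) Rtvs (fun p => U s (fst p))
      (fun p => om s (fst p) (fst (snd p)) (snd (snd p))) /\
    (forall x X Y, U s x -> om s (opp x) (opp X) (opp Y) = om s x X Y).

(** [om = d lam]:
    [om(X,Y) = d(lam Y)X - d(lam X)Y - lam[X,Y]] for all local vector fields. *)
Definition is_ext_derivative (E : bool -> tvs) (U : forall s, E s -> Prop)
    (lam : one_form E) (om : two_form E) : Prop :=
  forall (s : bool) (V : E s -> Prop) (x : E s) (X Y : E s -> E s),
    vector_field_near (E s) (U s) V x X ->
    vector_field_near (E s) (U s) V x Y ->
    exists (a b : R) (c : E s),
      is_dderive (E s) Rtvs (fun y => lam s y (Y y)) x (X x) a /\
      is_dderive (E s) Rtvs (fun y => lam s y (X y)) x (Y x) b /\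
      is_bracket (E s) X Y x c /\
      om s x (X x) (Y x) = a - b - lam s x c.

Definition is_closed (E : bool -> tvs) (U : forall s, E s -> Prop)
    (om : two_form E) : Prop :=
  forall (s : bool) (V : E s -> Prop) (x : E s) (X Y Z : E s -> E s),
    vector_field_near (E s) (U s) V x X ->
    vector_field_near (E s) (U s) V x Y ->
    vector_field_near (E s) (U s) V x Z ->
    exists (a b c : R) (xy xz yz : E s),
      is_dderive (E s) Rtvs (fun y => om s y (Y y) (Z y)) x (X x) a /\
      is_dderive (E s) Rtvs (fun y => om s y (X y) (Z y)) x (Y x) b /\
      is_dderive (E s) Rtvs (fun y => om s y (X y) (Y y)) x (Z x) c /\
      is_bracket (E s) X Y x xy /\
      is_bracket (E s) X Z x xz /\
      is_bracket (E s) Y Z x yz /\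
      a - b + c - om s x xy (Z x) + om s x xz (Y x) - om s x yz (X x) = 0.

Definition weak_symplectic (E : bool -> tvs) (U : forall s, E s -> Prop)
    (om : two_form E) : Prop :=
  is_two_form E U om /\
  is_closed E U om /\
  (forall s x X, U s x -> X <> zero -> exists Y : E s, om s x X Y <> 0).

(** * Spaces of smooth (twisted) loops in the plane *)

Definition curve_derive (k : nat) (z : R -> C) (tau : R) : C :=
  (Derive_n (fun t => Re (z t)) k tau, Derive_n (fun t => Im (z t)) k tau).

Definition smooth_curve (z : R -> C) : Prop :=
  forall k tau,
    ex_derive_n (fun t => Re (z t)) k tau /\
    ex_derive_n (fun t => Im (z t)) k tau.

Definition sgn (s : bool) : R := if s then 1 else -1.

(** [loop true] and [loop false] are the spaces of periodic and of
    antiperiodic smooth curves in the plane. *)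
Record loop (s : bool) : Type := Loop {
  loop_fun :> R -> C;
  loop_smooth : smooth_curve loop_fun;
  loop_twist : forall tau, loop_fun (tau + 1) = Cmult (sgn s) (loop_fun tau)
}.

Lemma loop_ext (s : bool) (z w : loop s) : (forall t, z t = w t) -> z = w.
Proof.
destruct z as [z hz kz], w as [w hw kw]; simpl; intros h.
assert (e : z = w) by (apply functional_extensionality; exact h).
subst w. f_equal; apply proof_irrelevance.
Qed.

Lemma smooth_curve_plus (z w : R -> C) :
  smooth_curve z -> smooth_curve w -> smooth_curve (fun t => Cplus (z t) (w t)).
Proof.
intros hz hw k tau; split; simpl;
  apply ex_derive_n_plus; exists (mkposreal 1 Rlt_0_1); intros y _ j _;
  first [apply hz | apply hw].
Qed.

Lemma smooth_curve_scal (a : R) (z : R -> C) :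
  smooth_curve z -> smooth_curve (fun t => (a * Re (z t), a * Im (z t))).
Proof.
intros hz k tau; split; simpl; apply ex_derive_n_scal_l; apply hz.
Qed.

Definition loop_plus (s : bool) (z w : loop s) : loop s.
Proof.
refine (Loop s (fun t => Cplus (z t) (w t))
  (smooth_curve_plus _ _ (loop_smooth s z) (loop_smooth s w)) _).
intros tau. rewrite !loop_twist. ring.
Defined.

Definition loop_scal (s : bool) (a : R) (z : loop s) : loop s.
Proof.
refine (Loop s (fun t => (a * Re (z t), a * Im (z t)))
  (smooth_curve_scal a _ (loop_smooth s z)) _).
intros tau. rewrite !loop_twist.
apply injective_projections; simpl; unfold Re, Im; ring.
Defined.

Definition loop_zero (s : bool) : loop s.
Proof.
refine (Loop s (fun _ => RtoC 0) _ _).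
- intros k tau; split; simpl; apply ex_derive_n_const.
- intros tau. ring.
Defined.

Definition loop_opp (s : bool) (z : loop s) : loop s := loop_scal s (-1) z.

Ltac loop_eq :=
  intros; apply loop_ext; intros t; apply injective_projections; simpl;
  unfold Re, Im, one, plus, mult; simpl; ring.

Definition loop_AbelianMonoid_mixin (s : bool) : AbelianMonoid.mixin_of (loop s).
Proof.
apply (AbelianMonoid.Mixin _ (loop_plus s) (loop_zero s)); loop_eq.
Defined.

Canonical loop_AbelianMonoid (s : bool) :=
  AbelianMonoid.Pack (loop s) (loop_AbelianMonoid_mixin s) (loop s).

Definition loop_AbelianGroup_mixin (s : bool) :
  AbelianGroup.mixin_of (loop_AbelianMonoid s).
Proof.
apply (AbelianGroup.Mixin (loop_AbelianMonoid s) (loop_opp s)); loop_eq.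
Defined.

Canonical loop_AbelianGroup (s : bool) :=
  AbelianGroup.Pack (loop s)
    (AbelianGroup.Class _ (loop_AbelianMonoid_mixin s) (loop_AbelianGroup_mixin s))
    (loop s).

Definition loop_ModuleSpace_mixin (s : bool) :
  ModuleSpace.mixin_of R_Ring (loop_AbelianGroup s).
Proof.
apply (ModuleSpace.Mixin R_Ring (loop_AbelianGroup s) (loop_scal s)); loop_eq.
Defined.

Definition loop_ModuleSpace_class (s : bool) : ModuleSpace.class_of R_Ring (loop s) :=
  ModuleSpace.Class R_Ring (loop s) (AbelianGroup.class (loop_AbelianGroup s))
    (loop_ModuleSpace_mixin s).

Canonical loop_ModuleSpace (s : bool) :=
  ModuleSpace.Pack R_Ring (loop s) (loop_ModuleSpace_class s) (loop s).

(** The [C^oo] topology: [w] is [e]-close to [z] when the derivatives of order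
    [k < 1 / e] of [z] and [w] are uniformly [e]-close.  Writing the bound on
    the order as [k * e < 1] makes balls of nonpositive radius empty. *)
Definition loop_ball (s : bool) (z : loop s) (e : R) (w : loop s) : Prop :=
  forall (k : nat) (tau : R), INR k * e < 1 ->
    Cmod (Cminus (curve_derive k z tau) (curve_derive k w tau)) < e.

Lemma loop_ball_pos (s : bool) (z w : loop s) (e : R) : loop_ball s z e w -> 0 < e.
Proof.
intros h. apply Rle_lt_trans with (2 := h 0%nat 0 ltac:(simpl; lra)).
apply Cmod_ge_0.
Qed.

Definition loop_UniformSpace_mixin (s : bool) : UniformSpace.mixin_of (loop s).
Proof.
apply (UniformSpace.Mixin (loop s) (loop_zero s) (loop_ball s)).
- intros z e k tau _. unfold Cminus. rewrite Cplus_opp_r, Cmod_0. apply cond_pos.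
- intros z w e h k tau hk. rewrite <- Cmod_opp, Copp_minus_distr. now apply h.
- intros x y z e1 e2 h1 h2 k tau hk.
  assert (p1 := loop_ball_pos _ _ _ _ h1).
  assert (p2 := loop_ball_pos _ _ _ _ h2).
  assert (pk := pos_INR k).
  replace (Cminus (curve_derive k x tau) (curve_derive k z tau))
    with (Cplus (Cminus (curve_derive k x tau) (curve_derive k y tau))
                (Cminus (curve_derive k y tau) (curve_derive k z tau))) by ring.
  eapply Rle_lt_trans; [apply Cmod_triangle|].
  apply Rplus_lt_compat; [apply h1 | apply h2]; nra.
Defined.

Canonical loop_UniformSpace (s : bool) :=
  UniformSpace.Pack (loop s) (loop_UniformSpace_mixin s) (loop s).

Canonical loop_tvs (s : bool) : tvs :=
  NormedModuleAux.Pack R_AbsRing (loop s)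
    (NormedModuleAux.Class R_AbsRing (loop s) (loop_ModuleSpace_class s)
       (loop_UniformSpace_mixin s))
    (loop s).

(** * The two-fold covers of the loop space and of its cotangent bundle *)

(** Nonzero loops with values in the preimage of [Q] under the squaring map. *)
Definition loops_in (Q : C -> Prop) (s : bool) (z : loop_tvs s) : Prop :=
  z <> zero /\ forall tau, Q (Cmult (z tau) (z tau)).

Definition cotangent_tvs (s : bool) : tvs := prodtvs (loop_tvs s) (loop_tvs s).

Definition cotangent_in (Q : C -> Prop) (s : bool) (p : cotangent_tvs s) : Prop :=
  loops_in Q s (fst p).

Definition pullback_one (lam : one_form loop_tvs) : one_form cotangent_tvs :=
  fun s p P => lam s (fst p) (fst P).

Definition pullback_two (om : two_form loop_tvs) : two_form cotangent_tvs :=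
  fun s p P P' => om s (fst p) (fst P) (fst P').

Definition inner (z w : R -> C) : R :=
  RInt (fun tau => Re (z tau) * Re (w tau) + Im (z tau) * Im (w tau)) 0 1.

Definition L2norm (z : R -> C) : R := sqrt (inner z z).

Definition Lambda : one_form cotangent_tvs :=
  fun s p P => inner (snd p : loop s) (fst P : loop s).

(** A smooth 1-periodic family of 1-forms on [Q]; [theta t q v] is the value
    of [theta_t] at [q] on the tangent vector [v]. *)
Definition periodic_family (Q : C -> Prop) (theta : R -> C -> C -> R) : Prop :=
  (forall t q, Q q -> linear_form Ctvs (theta t q)) /\
  smooth_on (prodtvs Rtvs (prodtvs Ctvs Ctvs)) Rtvs
    (fun p => Q (fst (snd p)))
    (fun p => theta (fst p) (fst (snd p)) (snd (snd p))) /\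
  (forall t q v, Q q -> theta (t + 1) q v = theta t q v).

(** Pullback of [theta_t] under [z |-> z^2], whose differential is
    [xi |-> 2 z xi]. *)
Definition vartheta (theta : R -> C -> C -> R) (t : R) (z xi : C) : R :=
  theta t (Cmult z z) (Cmult 2 (Cmult z xi)).

Definition time_change (z : R -> C) (tau : R) : R :=
  / L2norm z ^ 2 * RInt (fun sigma => Cmod (z sigma) ^ 2) 0 tau.

Definition Theta (theta : R -> C -> C -> R) : one_form loop_tvs :=
  fun s z xi =>
    RInt (fun tau => vartheta theta (time_change (z : loop s) tau)
                       ((z : loop s) tau) ((xi : loop s) tau)) 0 1.

Definition add_one (E : bool -> tvs) (lam mu : one_form E) : one_form E :=
  fun s x X => lam s x X + mu s x X.

Definition add_two (E : bool -> tvs) (om rho : two_form E) : two_form E :=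
  fun s x X Y => om s x X Y + rho s x X Y.

(* Main.v *)
Require Import Defs.
From Stdlib Require Import ZArith Reals Lra Lia Classical IndefiniteDescription FunctionalExtensionality.
From Coquelicot Require Import Coquelicot.
Open Scope R_scope.

(** For any smooth one-form [lam] on an open set of a vector space,
    [d lam (X, Y)] is the difference of the derivatives of [lam Y] along [X] and
    of [lam X] along [Y], with [X], [Y] frozen to constant fields.  Testing on
    constant fields shows that there is no other exterior derivative, and
    [d (d lam) = 0] reduces to the symmetry of second derivatives.  This needs
    the chain rule only for real-valued outer functions, where it follows from
    the one-dimensional mean value theorem, without any local convexity.

    [Lambda] and [Theta] are smooth because evaluation [(z, tau) |-> z tau] is
    jointly smooth, and integration over [[0, 1]] of a jointly smooth integrand
    preserves smoothness; the running integral in the time change becomes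
    [tau * int_0^1 |z (tau u)|^2 du].

    Finally [Omega ((x, e), (x', e')) = <e, x'> - <e', x>].  A nonzero [(x, e)]
    pairs nontrivially with [(0, x)] if [x <> 0] and with [(e, 0)] if [x = 0]; in
    both cases one of the arguments of [pi^* dTheta] is vertical, so the
    magnetic term vanishes. *)

(** Evaluation explains the choice of topology: differentiating [(z, t) |-> z t] in [t] produces
    [z'], so each differentiation costs one order of smoothness of the loop, and only a topology
    that controls all orders makes [z |-> z'] continuous. Such a topology comes without a norm,
    hence without uniform remainder estimates. Their substitute is the joint continuity of the
    differential in point and direction, which the notion of C^n contains. The differential of a map
    on [E] is a map on [E * E], so each closure property of C^n maps is an induction on [n] that
    must quantify over all spaces, with a differential built only from operations that the induction
    already covers. Exterior derivatives are specified by their values on all local fields. Freezing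
    the fields loses nothing, because the derivatives of varying fields enter through linear slots
    and are cancelled by the bracket terms. *)

(* A [tvs] carries a topology but its operations need not be continuous; this
   is the amount of continuity that directional calculus uses. *)
Record good (E : tvs) : Prop := {
  good_separated : forall x y : E, close x y -> x = y;
  good_segment : forall (x v : E) (eps : posreal), exists delta : posreal,
    forall (t : R) (y w : E), Rabs t < delta -> ball x delta y -> ball v delta w ->
    ball x eps (plus y (scal t w))
}.

Lemma ball_R (a e b : R) : ball (M := Rtvs) a e b <-> Rabs (b - a) < e.
Proof. reflexivity. Qed.

Lemma quot_R (h a b : R) : scal (V := Rtvs) (/ h) (minus (G := Rtvs) a b) = (a - b) / h.
Proof. unfold Rdiv. rewrite Rmult_comm. reflexivity. Qed.

Lemma plus_minus_r (G : tvs) (a b : G) : plus a (minus b a) = b.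
Proof.
rewrite plus_comm. transitivity (plus b (plus (opp a) a)).
- symmetry. apply plus_assoc.
- now rewrite (plus_opp_l a), plus_zero_r.
Qed.

Lemma ball_R_0 (e h : R) : ball (0 : R_AbsRing) e h <-> Rabs h < e.
Proof. change (Rabs (h - 0) < e <-> Rabs h < e). rewrite Rminus_0_r. tauto. Qed.

Lemma scal_0_l (E : tvs) (v : E) : scal (0 : R) v = (zero : E).
Proof. exact (scal_zero_l v). Qed.

Lemma plus_scal_0 (E : tvs) (x v : E) : plus x (scal (0 : R) v) = x.
Proof. now rewrite scal_0_l, plus_zero_r. Qed.

Lemma plus_scal_add (E : tvs) (x v : E) (a b : R) :
  plus x (scal (a + b) v) = plus (plus x (scal a v)) (scal b v).
Proof.
rewrite <- plus_assoc. f_equal. exact (scal_distr_r (a : R_Ring) b v).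
Qed.

(** * Directional derivatives *)

Lemma is_dderive_ball (E F : tvs) (f : E -> F) (x v : E) (l : F) :
  is_dderive E F f x v l <->
  forall eps : posreal, exists delta : posreal, forall h : R, h <> 0 -> Rabs h < delta ->
    ball l eps (scal (/ h) (minus (f (plus x (scal h v))) (f x))).
Proof.
unfold is_dderive. split; intros H; [|apply filterlim_locally]; intros eps.
- destruct (proj1 (filterlim_locally _ _) H eps) as [d Hd]. exists d. intros h h0 hd. apply Hd; auto. now apply ball_R_0.
- destruct (H eps) as [d Hd]. exists d. intros h hd h0. apply Hd; auto. now apply ball_R_0.
Qed.

Lemma is_dderive_R (E : tvs) (f : E -> R) (x v : E) (l : R) :
  is_dderive E Rtvs f x v l <-> is_derive (fun h : R => f (plus x (scal h v))) 0 l.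
Proof.
rewrite is_dderive_ball, is_derive_Reals. unfold derivable_pt_lim.
assert (e : forall h : R, h <> 0 ->
  scal (V := Rtvs) (/ h) (minus (f (plus x (scal h v))) (f x)) - l =
  (f (plus x (scal (0 + h) v)) - f (plus x (scal (0 : R) v))) / h - l).
{ intros h h0. rewrite plus_scal_0, Rplus_0_l.
  unfold scal, minus, plus, opp; simpl; unfold mult; simpl. now field. }
split; intros H eps.
- intros he. destruct (H (mkposreal eps he)) as [d Hd]. exists d. intros h h0 hd.
  rewrite <- e by assumption. now apply Hd.
- destruct (H eps (cond_pos eps)) as [d Hd]. exists d. intros h h0 hd.
  apply ball_R. rewrite e by assumption. now apply Hd.
Qed.

Lemma is_dderive_unique (E F : tvs) (f : E -> F) (x v : E) (l m : F) :
  good F -> is_dderive E F f x v l -> is_dderive E F f x v m -> l = m.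
Proof.
rewrite !is_dderive_ball. intros g hl hm. apply (good_separated F g). intros eps.
destruct (hl (pos_div_2 eps)) as [d1 h1], (hm (pos_div_2 eps)) as [d2 h2].
set (d := Rmin d1 d2). assert (0 < d) by (apply Rmin_pos; apply cond_pos).
assert (hd : d / 2 < d1 /\ d / 2 < d2).
{ generalize (Rmin_l d1 d2) (Rmin_r d1 d2); fold d; lra. }
assert (a : Rabs (d / 2) = d / 2) by (apply Rabs_pos_eq; lra).
rewrite <- (Rplus_half_diag eps). eapply ball_triangle.
- apply (h1 (d / 2)); [lra | rewrite a; tauto].
- apply ball_sym. apply (h2 (d / 2)); [lra | rewrite a; tauto].
Qed.

(** Makes directional derivatives local: changing a map off an open set does not affect them
    inside. *)
Lemma good_line (E : tvs) (x v : E) (U : E -> Prop) :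
  good E -> open U -> U x -> locally (0 : R) (fun h : R => U (plus x (scal h v))).
Proof.
intros g o u. destruct (o x u) as [e he].
destruct (good_segment E g x v e) as [d hd]. exists d. intros h hh. apply he, hd.
- now apply ball_R_0.
- apply ball_center.
- apply ball_center.
Qed.

Lemma good_Rtvs : good Rtvs.
Proof.
split.
- intros x y h. apply cond_eq. intros e he.
  rewrite Rabs_minus_sym. apply (h (mkposreal e he)).
- intros x v eps.
  assert (p := Rabs_pos v). assert (q := cond_pos eps).
  (* With [d <= 1] one has [Rabs w <= 1 + Rabs v], so the total error is at most
     [d + d * (1 + Rabs v) = d * (2 + Rabs v)]. *)
  set (d := Rmin 1 (eps / (2 + Rabs v))).
  assert (a : 0 < eps / (2 + Rabs v)) by (apply Rdiv_lt_0_compat; lra).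
  assert (hd : 0 < d) by (apply Rmin_pos; lra).
  exists (mkposreal d hd). simpl. intros t y w ht hy hw.
  apply (proj1 (ball_R _ _ _)) in hy; apply (proj1 (ball_R _ _ _)) in hw; apply ball_R.
  unfold plus, scal; simpl; unfold mult; simpl.
  assert (d * (2 + Rabs v) <= eps).
  { apply Rle_trans with (eps / (2 + Rabs v) * (2 + Rabs v)).
    - apply Rmult_le_compat_r; [lra | apply Rmin_r].
    - right. field. lra. }
  assert (d <= 1) by apply Rmin_l.
  replace (y + t * w - x) with ((y - x) + t * w) by ring.
  assert (Rabs w <= 1 + Rabs v).
  { replace w with ((w - v) + v) by ring. generalize (Rabs_triang (w - v) v). lra. }
  generalize (Rabs_triang (y - x) (t * w)). rewrite Rabs_mult.
  assert (Rabs t * Rabs w <= d * (1 + Rabs v)).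
  { apply Rmult_le_compat; auto using Rabs_pos; lra. }
  lra.
Qed.

Lemma good_prodtvs (E F : tvs) : good E -> good F -> good (prodtvs E F).
Proof.
intros gE gF. split.
- intros [x1 x2] [y1 y2] h. f_equal.
  + apply (good_separated E gE). intros e. apply (h e).
  + apply (good_separated F gF). intros e. apply (h e).
- intros [x1 x2] [v1 v2] e.
  destruct (good_segment E gE x1 v1 e) as [d1 h1], (good_segment F gF x2 v2 e) as [d2 h2].
  assert (hd : 0 < Rmin d1 d2) by (apply Rmin_pos; apply cond_pos).
  exists (mkposreal _ hd). simpl.
  intros t [y1 y2] [w1 w2] ht [hy1 hy2] [hw1 hw2]. simpl in *.
  assert (l := Rmin_l d1 d2). assert (r := Rmin_r d1 d2).
  split; simpl; [apply h1 | apply h2]; try lra; eapply ball_le; eauto.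
Qed.

(** * C^n maps *)

Lemma Cn_on_continuous n (E F : tvs) U f (x : E) :
  Cn_on n E F U f -> U x -> continuous f x.
Proof. destruct n; intros [h _]; apply h. Qed.

Lemma Cn_on_pred n (E F : tvs) U f : Cn_on (S n) E F U f -> Cn_on n E F U f.
Proof.
revert E U f. induction n as [|n IH]; intros E U f [c [df [h1 h2]]]; split; auto.
exists df. split; auto.
Qed.

Lemma is_dderive_ext_loc (E F : tvs) (U : E -> Prop) (f g : E -> F) (x v : E) (l : F) :
  good E -> open U -> U x -> (forall y, U y -> f y = g y) ->
  is_dderive E F f x v l -> is_dderive E F g x v l.
Proof.
intros gE o u e. rewrite !is_dderive_ball. intros H eps. destruct (H eps) as [d hd].
destruct (good_line E x v U gE o u) as [d' hd'].
assert (p : 0 < Rmin d d') by (apply Rmin_pos; apply cond_pos).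
exists (mkposreal _ p). simpl. intros h h0 hh.
rewrite <- !e; auto.
- apply hd; auto. generalize (Rmin_l d d'); lra.
- apply hd'. apply ball_R_0; generalize (Rmin_r d d'); lra.
Qed.

Lemma open_fst (E F : tvs) (U : E -> Prop) :
  open U -> open (fun p : prodtvs E F => U (fst p)).
Proof.
intros o [x y] h. destruct (o x h) as [e he]. exists e. intros [x' y'] [h1 h2]. now apply he.
Qed.

Lemma open_full (E : tvs) : open (fun _ : E => True).
Proof. apply open_true. Qed.

(** No induction: the old differential serves the new function, since derivatives at points of an
    open set see only values there. *)
Lemma Cn_on_ext n (E F : tvs) (U : E -> Prop) (f g : E -> F) :
  good E -> open U -> (forall y, U y -> f y = g y) -> Cn_on n E F U f -> Cn_on n E F U g.
Proof.
intros gE o e h.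
assert (c : forall x, U x -> continuous g x).
{ intros x u. apply continuous_ext_loc with f.
  - destruct (o x u) as [d hd]. exists d. intros y hy. now apply e, hd.
  - now apply Cn_on_continuous with (1 := h). }
destruct n; split; auto.
destruct h as [_ [df [h1 h2]]]. exists df. split; auto.
intros x v u. now apply is_dderive_ext_loc with (5 := h1 x v u) (U := U).
Qed.

(* Junk value: [Derive] is total, so [dd] means something only where [f] is
   known to be differentiable. *)
Definition dd (E : tvs) (f : E -> R) (p : prodtvs E E) : R :=
  Derive (fun h : R => f (plus (fst p) (scal h (snd p)))) 0.

Lemma is_dderive_dd (E : tvs) (f : E -> R) (x v : E) (l : R) :
  is_dderive E Rtvs f x v l -> dd E f (x, v) = l.
Proof. rewrite is_dderive_R. apply is_derive_unique. Qed.

(** Replaces the anonymous differential of the definition by the canonical [dd], so that derivatives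
    can be named and iterated. *)
Lemma Cn_on_dd n (E : tvs) (U : E -> Prop) (f : E -> R) :
  good E -> open U -> Cn_on (S n) E Rtvs U f ->
  Cn_on n (prodtvs E E) Rtvs (fun p => U (fst p)) (dd E f).
Proof.
intros g o [_ [df [h1 h2]]].
apply Cn_on_ext with (4 := h2).
- now apply good_prodtvs.
- now apply open_fst.
- intros [x v] u. symmetry. now apply is_dderive_dd, h1.
Qed.

Lemma Cn_on_is_dderive n (E : tvs) (U : E -> Prop) (f : E -> R) (x v : E) :
  Cn_on (S n) E Rtvs U f -> U x -> is_dderive E Rtvs f x v (dd E f (x, v)).
Proof.
intros [_ [df [h1 h2]]] u. rewrite (is_dderive_dd _ _ _ _ _ (h1 x v u)). now apply h1.
Qed.

(** Recentring the line at the parameter [t] gives differentiability all along the line, as the mean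
    value theorem requires. *)
Lemma Cn_on_is_derive n (E : tvs) (U : E -> Prop) (f : E -> R) (x v : E) (t : R) :
  Cn_on (S n) E Rtvs U f -> U (plus x (scal t v)) ->
  is_derive (fun h : R => f (plus x (scal h v))) t (dd E f (plus x (scal t v), v)).
Proof.
intros c u. assert (h := Cn_on_is_dderive n E U f _ v c u).
apply is_dderive_R in h.
apply (is_derive_ext (fun s => (fun h : R => f (plus (plus x (scal t v)) (scal h v))) (s - t))).
- intros s. rewrite <- plus_scal_add. exact (f_equal (fun r => f (plus x (scal r v))) (Rplus_minus t s)).
- set (l := dd _ _ _) in *.
  replace l with (scal (1 - 0) l) by (unfold scal; simpl; unfold mult; simpl; ring).
  apply (is_derive_comp (fun h : R => f (plus (plus x (scal t v)) (scal h v))) (fun s => s - t)).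
  + now rewrite Rminus_diag.
  + auto_derive; [exact I | ring].
Qed.

(* Base point and direction may move with the step [h]: the chain rule and the
   additivity of the derivative are both instances. *)
Lemma strong_derivative (E : tvs) (U : E -> Prop) (f : E -> R) (x v : E) (y w : R -> E) :
  good E -> open U -> Cn_on 1 E Rtvs U f -> U x ->
  filterlim y (locally' (0 : R)) (locally x) ->
  filterlim w (locally' (0 : R)) (locally v) ->
  forall eps : posreal, exists delta : posreal, forall h : R, h <> 0 -> Rabs h < delta ->
    Rabs ((f (plus (y h) (scal h (w h))) - f (y h)) / h - dd E f (x, v)) < eps.
Proof.
intros g o c u hy hw eps.
assert (k := Cn_on_dd 0 E U f g o c).
assert (k' := Cn_on_continuous _ _ _ _ _ (x, v) k u).
assert (hy' := proj1 (filterlim_locally y x) hy).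
assert (hw' := proj1 (filterlim_locally w v) hw).
(* [d1] comes from the joint continuity of [dd], [d2] keeps points in [U], and [d3] makes whole
   segments issuing from [y h] respect both. *)
destruct (proj1 (filterlim_locally _ _) k' eps) as [d1 h1].
destruct (o x u) as [d2 h2].
assert (p : 0 < Rmin d1 d2) by (apply Rmin_pos; apply cond_pos).
assert (pl := Rmin_l d1 d2). assert (pr := Rmin_r d1 d2).
destruct (good_segment E g x v (mkposreal _ p)) as [d3 h3].
assert (q : 0 < Rmin d1 d3) by (apply Rmin_pos; apply cond_pos).
assert (ql := Rmin_l d1 d3). assert (qr := Rmin_r d1 d3).
destruct (hy' (mkposreal _ q)) as [e1 k1].
destruct (hw' (mkposreal _ q)) as [e2 k2].
assert (r : 0 < Rmin d3 (Rmin e1 e2)) by (repeat apply Rmin_pos; apply cond_pos).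
exists (mkposreal _ r). simpl. intros h h0 hh.
assert (rl := Rmin_l d3 (Rmin e1 e2)). assert (rr := Rmin_r d3 (Rmin e1 e2)).
assert (sl := Rmin_l e1 e2). assert (sr := Rmin_r e1 e2).
assert (b1 : ball x (Rmin d1 d3) (y h)).
{ apply k1; auto. apply ball_R_0; lra. }
assert (b2 : ball v (Rmin d1 d3) (w h)).
{ apply k2; auto. apply ball_R_0; lra. }
assert (seg : forall t, Rmin 0 h <= t <= Rmax 0 h -> ball x (Rmin d1 d2) (plus (y h) (scal t (w h)))).
{ intros t ht. apply h3.
  - apply Rle_lt_trans with (Rabs h); [|lra].
    unfold Rmin, Rmax in ht. destruct (Rle_dec 0 h); unfold Rabs;
      destruct (Rcase_abs t), (Rcase_abs h); lra.
  - eapply ball_le; [|exact b1]; lra.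
  - eapply ball_le; [|exact b2]; lra. }
assert (der : forall t, Rmin 0 h <= t <= Rmax 0 h ->
  is_derive (fun t : R => f (plus (y h) (scal t (w h)))) t (dd E f (plus (y h) (scal t (w h)), w h))).
{ intros t ht. apply (Cn_on_is_derive 0 E U); auto. apply h2.
  eapply ball_le; [|apply seg; exact ht]; lra. }
(* The difference quotient equals [dd] at an intermediate point of the segment, with direction
   [w h]; this pair is close to [(x, v)]. *)
destruct (MVT_gen (fun t : R => f (plus (y h) (scal t (w h)))) 0 h
  (fun t => dd E f (plus (y h) (scal t (w h)), w h))) as [t [ht e]].
- intros t ht. apply der. lra.
- intros t ht. apply continuity_pt_filterlim. apply (ex_derive_continuous (V := R_NormedModule)).
  eexists. now apply der.
- rewrite plus_scal_0 in e. rewrite e.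
  replace (dd E f (plus (y h) (scal t (w h)), w h) * (h - 0) / h)
    with (dd E f (plus (y h) (scal t (w h)), w h)) by now field.
  apply h1. split; simpl.
  + eapply ball_le; [|now apply seg]; lra.
  + eapply ball_le; [|exact b2]; lra.
Qed.

(** Taking the direction [w h] to be the difference quotient of [g] makes [g x + h * w h] equal to
    [g (x + h v)] exactly, so [strong_derivative] applies with a fixed base point. *)
Lemma is_dderive_comp (E F : tvs) (V : F -> Prop) (f : F -> R) (g : E -> F) (x v : E) (w : F) :
  good F -> open V -> Cn_on 1 F Rtvs V f -> V (g x) -> is_dderive E F g x v w ->
  is_dderive E Rtvs (fun y => f (g y)) x v (dd F f (g x, w)).
Proof.
intros gF o c u d. apply is_dderive_ball. intros eps.
destruct (strong_derivative F V f (g x) w (fun _ => g x)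
  (fun h => scal (/ h) (minus (g (plus x (scal h v))) (g x))) gF o c u
  (filterlim_const _) d eps) as [delta hd].
exists delta. intros h h0 hh. apply ball_R. specialize (hd h h0 hh).
replace (plus (g x) (scal h (scal (/ h) (minus (g (plus x (scal h v))) (g x)))))
  with (g (plus x (scal h v))) in hd.
- unfold Rdiv in hd. rewrite Rmult_comm in hd. exact hd.
- rewrite (scal_assoc (h : R_Ring)).
  replace (mult (h : R_Ring) (/ h)) with (one : R_Ring).
  + rewrite scal_one. symmetry. apply plus_minus_r.
  + exact (eq_sym (Rinv_r h h0)).
Qed.

(** The increment from [x] to [x + h (a v + w)] is split at [x + h a v]. The second leg starts at a
    moving base point, which is where [strong_derivative] enters. *)
Lemma linear_form_dd (E : tvs) (U : E -> Prop) (f : E -> R) (x : E) :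
  good E -> open U -> Cn_on 1 E Rtvs U f -> U x -> linear_form E (fun v => dd E f (x, v)).
Proof.
intros g o c u a v w. apply is_dderive_dd, is_dderive_ball. intros eps.
assert (d1 := Cn_on_is_derive 0 E U f x v 0 c).
rewrite plus_scal_0 in d1. specialize (d1 u).
assert (d2 : is_dderive E Rtvs f x (scal a v) (a * dd E f (x, v))).
{ apply is_dderive_R.
  apply (is_derive_ext (fun h : R => (fun h => f (plus x (scal h v))) (h * a))).
  - intros t. now rewrite (scal_assoc (t : R_Ring)).
  - apply (is_derive_comp (V := R_NormedModule) (fun h : R => f (plus x (scal h v)))).
    + now rewrite Rmult_0_l.
    + auto_derive; [exact I | ring]. }
destruct (strong_derivative E U f x w (fun h => plus x (scal h (scal a v))) (fun _ => w)
  g o c u) with (eps := pos_div_2 eps) as [e1 h1].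
- apply filterlim_locally. intros e.
  destruct (good_segment E g x (scal a v) e) as [d hd]. exists d.
  intros h hh _. apply hd; try apply ball_center. now apply ball_R_0.
- apply filterlim_const.
- destruct (proj1 (is_dderive_ball _ _ _ _ _ _) d2 (pos_div_2 eps)) as [e2 h2].
  assert (r : 0 < Rmin e1 e2) by (apply Rmin_pos; apply cond_pos).
  assert (sl := Rmin_l e1 e2). assert (sr := Rmin_r e1 e2).
  exists (mkposreal _ r). simpl. intros h h0 hh. apply ball_R.
  specialize (h1 h h0 ltac:(lra)). specialize (h2 h h0 ltac:(lra)). apply (proj1 (ball_R _ _ _)) in h2.
  simpl in h1, h2.
  rewrite scal_distr_l, plus_assoc.
  rewrite quot_R in h2. rewrite quot_R.
  rewrite <- (Rplus_half_diag eps).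
  eapply Rle_lt_trans; [|apply Rplus_lt_compat; [exact h1 | exact h2]].
  eapply Rle_trans; [|apply Rabs_triang]. right. f_equal. unfold Rdiv. ring.
Qed.

(** * Continuous linear maps and composition *)

(** One identity along lines, matched to difference quotients. It already gives linearity:
    [x = v = zero] yields [L zero = zero], and then [x = zero] yields homogeneity. *)
Record clinear (E F : tvs) (L : E -> F) : Prop := {
  clinear_line : forall (x v : E) (h : R), L (plus x (scal h v)) = plus (L x) (scal h (L v));
  clinear_continuous : forall x : E, continuous L x
}.

Lemma clinear_comp (E F G : tvs) (L : F -> G) (M : E -> F) :
  clinear F G L -> clinear E F M -> clinear E G (fun x => L (M x)).
Proof.
intros [l1 c1] [l2 c2]. split.
- intros x v h. now rewrite l2, l1.
- intros x. now apply (continuous_comp M L).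
Qed.

Lemma continuous_pair (E F G : tvs) (f : E -> F) (g : E -> G) (x : E) :
  continuous f x -> continuous g x -> continuous (U := prodtvs F G) (fun y => (f y, g y)) x.
Proof.
intros hf hg. apply filterlim_locally. intros eps.
assert (a := proj1 (filterlim_locally _ _) hf eps).
assert (b := proj1 (filterlim_locally _ _) hg eps).
generalize (filter_and _ _ a b). apply filter_imp. intros y [h1 h2]. now split.
Qed.

Lemma clinear_pair (E F G : tvs) (L : E -> F) (M : E -> G) :
  clinear E F L -> clinear E G M -> clinear E (prodtvs F G) (fun x => (L x, M x)).
Proof.
intros [l1 c1] [l2 c2]. split.
- intros x v h. now rewrite l2, l1.
- intros x. now apply continuous_pair.
Qed.

Lemma clinear_id (E : tvs) : clinear E E (fun x => x).
Proof. split; [reflexivity | intros x; apply continuous_id]. Qed.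

Lemma clinear_fst (E F : tvs) : clinear (prodtvs E F) E fst.
Proof.
split; [reflexivity|]. intros x. apply filterlim_locally. intros eps.
exists eps. intros y [h _]. exact h.
Qed.

Lemma clinear_snd (E F : tvs) : clinear (prodtvs E F) F snd.
Proof.
split; [reflexivity|]. intros x. apply filterlim_locally. intros eps.
exists eps. intros y [_ h]. exact h.
Qed.

Lemma clinear_zero (E F : tvs) : clinear E F (fun _ => zero).
Proof.
split; [|intros x; apply continuous_const].
intros x v h. rewrite plus_zero_l. symmetry. exact (scal_zero_r (h : R_Ring)).
Qed.

Lemma is_dderive_clinear (E F G : tvs) (L : E -> F) (f : F -> G) (x v : E) (l : G) :
  clinear E F L -> is_dderive F G f (L x) (L v) l ->
  is_dderive E G (fun y => f (L y)) x v l.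
Proof.
intros [l1 _]. rewrite !is_dderive_ball. intros H eps. destruct (H eps) as [d hd].
exists d. intros h h0 hh. rewrite l1. now apply hd.
Qed.

(** Lines go to lines, so the difference quotients agree exactly and any target space is allowed;
    [Cn_on_comp] admits nonlinear inner maps but only real values. *)
Lemma Cn_on_clinear n (E F G : tvs) (L : E -> F) U (f : F -> G) :
  clinear E F L -> Cn_on n F G U f -> Cn_on n E G (fun x => U (L x)) (fun x => f (L x)).
Proof.
revert E F L U f. induction n as [|n IH]; intros E F L U f hL [c h]; split.
1, 3: intros x u; apply (continuous_comp L f); [apply hL | now apply c].
- exact I.
- destruct h as [df [h1 h2]]. exists (fun p => df (L (fst p), L (snd p))). split.
  + intros x v u. apply is_dderive_clinear; auto.
  + apply (IH (prodtvs E E) (prodtvs F F) (fun p => (L (fst p), L (snd p)))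
             (fun p => U (fst p)) df); auto.
    apply clinear_pair; apply clinear_comp; auto using clinear_fst, clinear_snd.
Qed.

Lemma is_dderive_id (E : tvs) (x v : E) : is_dderive E E (fun y => y) x v v.
Proof.
apply is_dderive_ball. intros eps. exists eps. intros h h0 _.
replace (scal (/ h) (minus (plus x (scal h v)) x)) with v; [apply ball_center|].
unfold minus. rewrite (plus_comm x).
transitivity (scal (/ h) (scal h v)).
- rewrite (scal_assoc (/ h : R_Ring)). replace (mult (/ h : R_Ring) h) with (one : R_Ring).
  + symmetry. apply (scal_one (V := NormedModuleAux.ModuleSpace _ E)).
  + exact (eq_sym (Rinv_l h h0)).
- f_equal. transitivity (plus (scal h v) (plus x (opp x))).
  + transitivity (plus (scal h v) (zero : E)).
    * symmetry. apply plus_zero_r.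
    * f_equal. symmetry. exact (plus_opp_r x).
  + apply plus_assoc.
Qed.

Lemma is_dderive_const (E F : tvs) (c : F) (x v : E) :
  is_dderive E F (fun _ => c) x v zero.
Proof.
apply is_dderive_ball. intros eps. exists eps. intros h h0 _.
replace (scal (/ h) (minus c c)) with (zero : F); [apply ball_center|].
symmetry. transitivity (scal (/ h : R_Ring) (zero : F)).
- f_equal. exact (plus_opp_r c).
- apply (scal_zero_r (V := NormedModuleAux.ModuleSpace _ F)).
Qed.

Lemma Cn_on_const n (E F : tvs) U (c : F) : Cn_on n E F U (fun _ => c).
Proof.
revert E U c. induction n as [|n IH]; intros E U c; split.
1, 3: intros x _; apply continuous_const.
- exact I.
- exists (fun _ => zero). split; auto. intros. apply is_dderive_const.
Qed.

Lemma Cn_on_of_clinear n (E F : tvs) U (L : E -> F) : clinear E F L -> Cn_on n E F U L.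
Proof.
intros hL. destruct n; split.
1, 3: intros x _; apply hL.
- exact I.
- exists (fun p => L (snd p)). split.
  + intros x v _. apply (is_dderive_clinear E F F L (fun y => y)); auto. apply is_dderive_id.
  (* The differential [L (snd p)] is independent of the base point and again linear in the pair, so
     the induction runs on maps of this shape. *)
  + clear -hL. revert E U L hL. induction n as [|n IH]; intros E U L hL; split.
    1, 3: intros x _; apply clinear_comp; auto using clinear_snd.
    * exact I.
    * exists (fun p => L (snd (snd p))). split.
      -- intros x v _.
         apply (is_dderive_clinear (prodtvs E E) F F (fun p => L (snd p)) (fun y => y)); auto.
         ++ apply clinear_comp; auto using clinear_snd.
         ++ apply is_dderive_id.
      -- apply (IH (prodtvs E E) (fun p => U (fst p)) (fun p => L (snd p))).
         apply clinear_comp; auto using clinear_snd.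
Qed.

Lemma is_dderive_pair (E F G : tvs) (f : E -> F) (g : E -> G) (x v : E) (l : F) (m : G) :
  is_dderive E F f x v l -> is_dderive E G g x v m ->
  is_dderive E (prodtvs F G) (fun y => (f y, g y)) x v (l, m).
Proof.
rewrite !is_dderive_ball. intros hf hg eps.
destruct (hf eps) as [d1 h1], (hg eps) as [d2 h2].
assert (r : 0 < Rmin d1 d2) by (repeat apply Rmin_pos; apply cond_pos).
assert (sl := Rmin_l d1 d2). assert (sr := Rmin_r d1 d2).
exists (mkposreal _ r). simpl. intros h h0 hh. split; [apply h1 | apply h2]; auto; lra.
Qed.

Lemma Cn_on_pair n (E F G : tvs) U (f : E -> F) (g : E -> G) :
  Cn_on n E F U f -> Cn_on n E G U g -> Cn_on n E (prodtvs F G) U (fun x => (f x, g x)).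
Proof.
revert E U f g. induction n as [|n IH]; intros E U f g [c h] [c' h']; split.
1, 3: intros x u; apply continuous_pair; auto.
- exact I.
- destruct h as [df [h1 h2]], h' as [dg [k1 k2]].
  exists (fun p => (df p, dg p)). split; auto.
  intros x v u. apply is_dderive_pair; auto.
Qed.

Lemma Cn_on_fst n (E F G : tvs) U (f : E -> G) :
  Cn_on n E G U f -> Cn_on n (prodtvs E F) G (fun p => U (fst p)) (fun p => f (fst p)).
Proof. apply (Cn_on_clinear n (prodtvs E F) E G fst). apply clinear_fst. Qed.

(** The differential of the composite is [dd F f] after [(g (fst p), dg p)]: again a real-valued map
    after an inner map, one order lower and on larger spaces. *)
Lemma Cn_on_comp n (E F : tvs) (U : E -> Prop) (V : F -> Prop) (f : F -> R) (g : E -> F) :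
  good F -> open V -> (forall x, U x -> V (g x)) ->
  Cn_on n E F U g -> Cn_on n F Rtvs V f -> Cn_on n E Rtvs U (fun x => f (g x)).
Proof.
revert E F U V f g.
induction n as [|n IH]; intros E F U V f g gF o s hg hf; split.
1, 3: intros x u; apply (continuous_comp g f);
  [now apply (Cn_on_continuous _ _ _ _ _ x hg) | now apply (Cn_on_continuous _ _ _ _ _ _ hf), s].
- exact I.
- assert (hg' := Cn_on_pred _ _ _ _ _ hg).
  destruct hg as [_ [dg [h1 h2]]].
  exists (fun p => dd F f (g (fst p), dg p)). split.
  + intros x v u. apply (is_dderive_comp E F V); auto.
    clear -hf. induction n; auto. apply IHn. now apply Cn_on_pred.
  + apply (IH (prodtvs E E) (prodtvs F F) (fun p => U (fst p)) (fun p => V (fst p)) (dd F f)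
              (fun p => (g (fst p), dg p))).
    * now apply good_prodtvs.
    * now apply open_fst.
    * intros p u. now apply s.
    * apply Cn_on_pair; auto. now apply Cn_on_fst.
    * now apply Cn_on_dd.
Qed.

(** * Sums, products and reciprocals of real-valued maps *)

Lemma is_dderive_plus (E : tvs) (f g : E -> R) (x v : E) (l m : R) :
  is_dderive E Rtvs f x v l -> is_dderive E Rtvs g x v m ->
  is_dderive E Rtvs (fun y => f y + g y) x v (l + m).
Proof. rewrite !is_dderive_R. intros h1 h2. exact (is_derive_plus _ _ _ _ _ h1 h2). Qed.

Lemma is_dderive_minus (E : tvs) (f g : E -> R) (x v : E) (l m : R) :
  is_dderive E Rtvs f x v l -> is_dderive E Rtvs g x v m ->
  is_dderive E Rtvs (fun y => f y - g y) x v (l - m).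
Proof. rewrite !is_dderive_R. intros h1 h2. exact (is_derive_minus _ _ _ _ _ h1 h2). Qed.

Lemma is_dderive_mult (E : tvs) (f g : E -> R) (x v : E) (l m : R) :
  is_dderive E Rtvs f x v l -> is_dderive E Rtvs g x v m ->
  is_dderive E Rtvs (fun y => f y * g y) x v (l * g x + f x * m).
Proof.
rewrite !is_dderive_R. intros h1 h2.
assert (h := is_derive_mult _ _ _ _ _ h1 h2 Rmult_comm). cbv beta in h.
rewrite !plus_scal_0 in h. exact h.
Qed.

Lemma is_dderive_inv (E : tvs) (f : E -> R) (x v : E) (l : R) :
  is_dderive E Rtvs f x v l -> f x <> 0 ->
  is_dderive E Rtvs (fun y => / f y) x v (- l * (/ f x * / f x)).
Proof.
rewrite !is_dderive_R. intros h1 h2.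
assert (h := is_derive_inv _ _ _ h1). cbv beta in h.
rewrite !plus_scal_0 in h. specialize (h h2).
replace (- l * (/ f x * / f x)) with (- l / f x ^ 2); [exact h | now field].
Qed.

Lemma Cn_on_plus n (E : tvs) U (f g : E -> R) :
  Cn_on n E Rtvs U f -> Cn_on n E Rtvs U g -> Cn_on n E Rtvs U (fun x => f x + g x).
Proof.
revert E U f g. induction n as [|n IH]; intros E U f g [c h] [c' h']; split.
1, 3: intros x u; apply (continuous_plus (V := R_NormedModule) f g); auto; fail.
- exact I.
- destruct h as [df [h1 h2]], h' as [dg [k1 k2]].
  exists (fun p => df p + dg p). split; auto.
  intros x v u. apply is_dderive_plus; auto.
Qed.

Lemma Cn_on_mult n (E : tvs) U (f g : E -> R) :
  Cn_on n E Rtvs U f -> Cn_on n E Rtvs U g -> Cn_on n E Rtvs U (fun x => f x * g x).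
Proof.
revert E U f g. induction n as [|n IH]; intros E U f g hf hg; split.
1, 3: intros x u; apply (continuous_mult (K := R_AbsRing) f g);
  [now apply (Cn_on_continuous _ _ _ _ _ x hf) | now apply (Cn_on_continuous _ _ _ _ _ x hg)].
- exact I.
- assert (hf' := Cn_on_pred _ _ _ _ _ hf). assert (hg' := Cn_on_pred _ _ _ _ _ hg).
  destruct hf as [_ [df [h1 h2]]], hg as [_ [dg [k1 k2]]].
  exists (fun p => df p * g (fst p) + f (fst p) * dg p). split.
  + intros x v u. apply is_dderive_mult; auto.
  + apply Cn_on_plus; apply IH; auto; now apply Cn_on_fst.
Qed.

Lemma Cn_on_minus n (E : tvs) U (f g : E -> R) :
  Cn_on n E Rtvs U f -> Cn_on n E Rtvs U g -> Cn_on n E Rtvs U (fun x => f x - g x).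
Proof.
intros hf hg.
replace (fun x => f x - g x) with (fun x => f x + (-1) * g x).
- apply Cn_on_plus, Cn_on_mult; auto. apply (Cn_on_const n E Rtvs).
- apply functional_extensionality. intros x. ring.
Qed.

(** The differential is written with products of reciprocals so that the induction hypothesis and
    [Cn_on_mult] cover it; [0 - df p] replaces the negation so that [Cn_on_minus] applies. *)
Lemma Cn_on_inv n (E : tvs) (U : E -> Prop) (f : E -> R) :
  (forall x, U x -> f x <> 0) -> Cn_on n E Rtvs U f -> Cn_on n E Rtvs U (fun x => / f x).
Proof.
revert E U f. induction n as [|n IH]; intros E U f nz hf; split.
1, 3: intros x u; apply (continuous_comp (V := R_UniformSpace) (W := R_UniformSpace) f Rinv);
  [now apply (Cn_on_continuous _ _ _ _ _ x hf) | now apply continuous_Rinv, nz].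
- exact I.
- assert (hf' := Cn_on_pred _ _ _ _ _ hf).
  destruct hf as [_ [df [h1 h2]]].
  exists (fun p => (0 - df p) * (/ f (fst p) * / f (fst p))). split.
  + intros x v u. rewrite Rminus_0_l. apply is_dderive_inv; auto.
  + apply Cn_on_mult; [|apply Cn_on_mult].
    * apply Cn_on_minus; auto. apply (Cn_on_const n (prodtvs E E) Rtvs).
    * apply (Cn_on_fst n E E Rtvs U (fun x => / f x)). now apply IH.
    * apply (Cn_on_fst n E E Rtvs U (fun x => / f x)). now apply IH.
Qed.

(** * Parametric integrals *)

(** Compactness of the interval turns local radii into one uniform radius. Both the continuity of
    parametric integrals and the openness of the set of admissible loops rest on it. *)
Lemma tube_lemma (E : tvs) (P : E -> R -> Prop) (x : E) :
  (forall s, 0 <= s <= 1 -> exists d : posreal,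
     forall y t, ball x d y -> Rabs (t - s) < d -> P y t) ->
  locally x (fun y => forall t, 0 <= t <= 1 -> P y t).
Proof.
intros h.
destruct (functional_choice (fun (s : R) (d : posreal) => 0 <= s <= 1 ->
  forall y t, ball x d y -> Rabs (t - s) < d -> P y t)) as [delta hd].
- intros s. destruct (classic (0 <= s <= 1)) as [k|k].
  + destruct (h s k) as [d hd]. now exists d.
  + exists (mkposreal 1 Rlt_0_1). tauto.
(* A centre [s] near [t] with [d <= delta s] is available only up to double negation, hence the
   proof by contradiction. *)
- destruct (compactness_value_1d 0 1 delta) as [d H]. exists d. intros y hy t ht.
  apply NNPP. intros np. apply (H t ht). intros [s [hs [h1 h2]]]. apply np.
  apply (hd s hs); auto. eapply ball_le; eauto.
Qed.

Lemma plus_scal_fst (E : tvs) (x v : E) (s h : R) :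
  plus ((x, s) : prodtvs E Rtvs) (scal h ((v, 0) : prodtvs E Rtvs)) = (plus x (scal h v), s).
Proof.
apply injective_projections; [reflexivity|].
change (s + h * 0 = s). ring.
Qed.

Lemma continuous_slice n (E : tvs) (U : E -> Prop) (F : prodtvs E Rtvs -> R) (x : E) (s : R) :
  Cn_on n (prodtvs E Rtvs) Rtvs (fun p => U (fst p)) F -> U x ->
  continuous (fun t : R => F (x, t)) s.
Proof.
intros c u. apply (continuous_comp (fun t : R => (x, t) : prodtvs E Rtvs) F).
- apply (continuous_pair Rtvs E Rtvs); [apply continuous_const | apply continuous_id].
- now apply (Cn_on_continuous _ _ _ _ _ (x, s) c).
Qed.

Lemma ex_RInt_slice n (E : tvs) (U : E -> Prop) (F : prodtvs E Rtvs -> R) (x : E) (a b : R) :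
  Cn_on n (prodtvs E Rtvs) Rtvs (fun p => U (fst p)) F -> U x ->
  ex_RInt (fun t : R => F (x, t)) a b.
Proof.
intros c u. apply (ex_RInt_continuous (V := R_CompleteNormedModule)).
intros z _. now apply (continuous_slice n E U).
Qed.

Lemma continuous_RInt_param n (E : tvs) (U : E -> Prop) (F : prodtvs E Rtvs -> R) (x : E) :
  open U -> Cn_on n (prodtvs E Rtvs) Rtvs (fun p => U (fst p)) F -> U x ->
  continuous (U := Rtvs) (fun x => RInt (fun s => F (x, s)) 0 1) x.
Proof.
intros o hF u. apply filterlim_locally. intros eps.
(* Uniform closeness of the two slices; [U y] is carried along for the integrability of the slice at
   [y]. Both values are compared with [F (x, s)], each within a quarter of [eps]. *)
assert (T : locally x (fun y => forall t, 0 <= t <= 1 ->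
    U y /\ Rabs (F (y, t) - F (x, t)) <= eps / 2)).
{ apply tube_lemma. intros s hs.
  assert (hc := Cn_on_continuous _ _ _ _ _ (x, s) hF u).
  destruct (proj1 (filterlim_locally _ _) hc (pos_div_2 (pos_div_2 eps))) as [d hd].
  destruct (o x u) as [e he].
  assert (r : 0 < Rmin d e) by (repeat apply Rmin_pos; apply cond_pos).
  assert (sl := Rmin_l d e). assert (sr := Rmin_r d e).
  exists (mkposreal _ r). simpl. intros y t hy ht. split; [apply he; eapply ball_le; eauto|].
  assert (h1 : Rabs (F (y, t) - F (x, s)) < eps / 2 / 2)
    by (apply (hd (y, t)); split; simpl; [eapply ball_le; eauto | apply ball_R; lra]).
  assert (h2 : Rabs (F (x, t) - F (x, s)) < eps / 2 / 2)
    by (apply (hd (x, t)); split; simpl; [apply ball_center | apply ball_R; lra]).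
  replace (F (y, t) - F (x, t)) with ((F (y, t) - F (x, s)) + - (F (x, t) - F (x, s))) by ring.
  eapply Rle_trans; [apply Rabs_triang|]. rewrite Rabs_Ropp. lra. }
revert T. apply filter_imp. intros y hy.
assert (uy : U y) by (apply (hy 0); lra).
assert (i1 := ex_RInt_slice _ E U F x 0 1 hF u).
assert (i2 := ex_RInt_slice _ E U F y 0 1 hF uy).
assert (B : Rabs (RInt (fun s => F (y, s) - F (x, s)) 0 1) <= (1 - 0) * (eps / 2)).
{ apply abs_RInt_le_const; [lra | exact (ex_RInt_minus (V := R_NormedModule) _ _ 0 1 i2 i1) |].
  intros t ht. now apply hy. }
assert (e : RInt (fun s => F (y, s) - F (x, s)) 0 1 =
  RInt (fun s => F (y, s)) 0 1 - RInt (fun s => F (x, s)) 0 1)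
  by exact (RInt_minus (V := R_CompleteNormedModule) _ _ 0 1 i2 i1).
rewrite e in B. apply ball_R. eapply Rle_lt_trans; [exact B|]. generalize (cond_pos eps). lra.
Qed.

(** Differentiation under the integral sign. The direction has component [0] in the integration
    variable, so the new integrand is [dd] of the old one after a linear rearrangement, and the
    induction continues on [E * E]. *)
Lemma Cn_on_RInt n (E : tvs) (U : E -> Prop) (F : prodtvs E Rtvs -> R) :
  good E -> open U -> Cn_on n (prodtvs E Rtvs) Rtvs (fun p => U (fst p)) F ->
  Cn_on n E Rtvs U (fun x => RInt (fun s => F (x, s)) 0 1).
Proof.
revert E U F. induction n as [|n IH]; intros E U F g o hF.
all: assert (c := fun x u => continuous_RInt_param _ E U F x o hF u).
- now split.
- split; auto.
  assert (gR : good (prodtvs E Rtvs)) by auto using good_prodtvs, good_Rtvs.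
  assert (oR := open_fst E Rtvs U o).
  assert (cdd := Cn_on_dd n _ _ _ gR oR hF).
  exists (fun p : prodtvs E E => RInt (fun s => dd _ F ((fst p, s), (snd p, 0))) 0 1). split.
  + intros x v u. apply is_dderive_R. cbv beta. simpl fst; simpl snd.
    assert (der : forall h t, U (plus x (scal h v)) ->
      is_derive (fun k : R => F (plus x (scal k v), t)) h (dd _ F ((plus x (scal h v), t), (v, 0)))).
    { intros h t uh.
      apply (is_derive_ext (fun k : R => F (plus ((x, t) : prodtvs E Rtvs) (scal k ((v, 0) : prodtvs E Rtvs))))).
      - intros k. now rewrite plus_scal_fst.
      - rewrite <- plus_scal_fst.
        apply (Cn_on_is_derive n (prodtvs E Rtvs) (fun p => U (fst p))); auto. }
    assert (L := good_line E x v U g o u).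
    (* The rule for parametric integrals speaks of [Derive] of the slices, which agrees with [dd] in
       the direction [(v, 0)]. *)
    replace (RInt (fun s => dd _ F ((x, s), (v, 0))) 0 1)
      with (RInt (fun s => Derive (fun h : R => F (plus x (scal h v), s)) 0) 0 1).
    2: { apply RInt_ext. intros s _. apply is_derive_unique.
         assert (k := der 0 s). rewrite plus_scal_0 in k. now apply k. }
    apply (is_derive_RInt_param (fun h s => F (plus x (scal h v), s)) 0 1 0).
    * revert L. apply filter_imp. intros h uh t _. eexists. now apply der.
    * intros t _.
      apply continuity_2d_pt_ext_loc with
        (fun h s => dd _ F ((plus x (scal h v), s), (v, 0))).
      -- destruct L as [d hd]. exists d. intros h s hh _. symmetry.
         apply is_derive_unique, der, hd. rewrite Rminus_0_r in hh. now apply ball_R_0.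
      -- intros eps.
         assert (hc := Cn_on_continuous _ _ _ _ _ ((x, t), (v, 0)) cdd u).
         destruct (proj1 (filterlim_locally _ _) hc eps) as [d hd].
         destruct (good_segment E g x v d) as [e he].
         assert (r : 0 < Rmin d e) by (repeat apply Rmin_pos; apply cond_pos).
         assert (sl := Rmin_l d e). assert (sr := Rmin_r d e).
         exists (mkposreal _ r). simpl. intros h s hh hs.
         rewrite plus_scal_0. apply hd. split; split; simpl.
         ++ apply he; try apply ball_center. rewrite Rminus_0_r in hh. lra.
         ++ apply ball_R. lra.
         ++ apply ball_center.
         ++ apply ball_center.
    * revert L. apply filter_imp. intros h uh. now apply (ex_RInt_slice (S n) E U).
  + apply (IH (prodtvs E E) (fun p => U (fst p))
      (fun q => dd _ F ((fst (fst q), snd q), (snd (fst q), 0)))).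
    * now apply good_prodtvs.
    * now apply open_fst.
    * apply (Cn_on_clinear n (prodtvs (prodtvs E E) Rtvs)
        (prodtvs (prodtvs E Rtvs) (prodtvs E Rtvs)) Rtvs
        (fun q => ((fst (fst q), snd q), (snd (fst q), 0))) (fun p => U (fst (fst p))) (dd _ F)); auto.
      repeat apply clinear_pair.
      -- apply (clinear_comp _ (prodtvs E E)); apply clinear_fst.
      -- apply clinear_snd.
      -- apply (clinear_comp _ (prodtvs E E) E snd fst); [apply clinear_snd | apply clinear_fst].
      -- apply (clinear_zero _ Rtvs).
Qed.

(** * Second derivatives *)

Lemma Cn_on_slice n (E F : tvs) (U : E -> Prop) (f : prodtvs E F -> R) (w : F) :
  good E -> good F -> open U -> Cn_on n (prodtvs E F) Rtvs (fun p => U (fst p)) f ->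
  Cn_on n E Rtvs U (fun y => f (y, w)).
Proof.
intros gE gF o c. apply (Cn_on_comp n E (prodtvs E F) U (fun p => U (fst p)) f (fun y => (y, w))); auto.
- now apply good_prodtvs.
- now apply open_fst.
- apply Cn_on_pair.
  + apply Cn_on_of_clinear, clinear_id.
  + apply Cn_on_const.
Qed.

Definition plane (E : tvs) (x X Y : E) (u v : R) : E := plus (plus x (scal u X)) (scal v Y).

Lemma plane_swap (E : tvs) (x X Y : E) (u v : R) : plane E x X Y u v = plane E x Y X v u.
Proof. unfold plane. rewrite <- !plus_assoc. f_equal. apply plus_comm. Qed.

Lemma plane_0 (E : tvs) (x X Y : E) : plane E x X Y 0 0 = x.
Proof. unfold plane. now rewrite !plus_scal_0. Qed.

Lemma locally_plane (E : tvs) (P : E -> Prop) (x X Y : E) :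
  good E -> locally x P -> locally_2d (fun u v => P (plane E x X Y u v)) 0 0.
Proof.
intros g [e he].
destruct (good_segment E g x Y e) as [d hd].
destruct (good_segment E g x X d) as [d' hd'].
assert (r : 0 < Rmin d d') by (repeat apply Rmin_pos; apply cond_pos).
assert (sl := Rmin_l d d'). assert (sr := Rmin_r d d').
exists (mkposreal _ r). simpl. intros u v hu hv. rewrite Rminus_0_r in hu, hv.
apply he, hd; try apply ball_center; try lra.
apply hd'; try apply ball_center; lra.
Qed.

Lemma is_derive_plane_r (E : tvs) (U : E -> Prop) (f : E -> R) (x X Y : E) (u v : R) :
  Cn_on 1 E Rtvs U f -> U (plane E x X Y u v) ->
  is_derive (fun t : R => f (plane E x X Y u t)) v (dd E f (plane E x X Y u v, Y)).
Proof. intros c h. exact (Cn_on_is_derive 0 E U f _ _ _ c h). Qed.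

Lemma is_derive_plane_l (E : tvs) (U : E -> Prop) (f : E -> R) (x X Y : E) (u v : R) :
  Cn_on 1 E Rtvs U f -> U (plane E x X Y u v) ->
  is_derive (fun t : R => f (plane E x X Y t v)) u (dd E f (plane E x X Y u v, X)).
Proof.
intros c h. rewrite plane_swap in h |- *.
apply (is_derive_ext (fun t : R => f (plane E x Y X v t))).
- intros t. f_equal. apply plane_swap.
- now apply (is_derive_plane_r E U).
Qed.

(** Restricted to the plane through [x] spanned by [X] and [Y], both sides are mixed partials at the
    origin of a function of two real variables, so Schwarz's theorem applies. *)
Lemma dd_symmetric (E : tvs) (U : E -> Prop) (f : E -> R) (x X Y : E) :
  good E -> open U -> Cn_on 2 E Rtvs U f -> U x ->
  dd E (fun y => dd E f (y, Y)) (x, X) = dd E (fun y => dd E f (y, X)) (x, Y).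
Proof.
intros g o c u.
assert (cdd := Cn_on_dd 1 E U f g o c).
assert (c1 := Cn_on_pred _ _ _ _ _ c).
assert (cX := Cn_on_slice 1 E E U _ X g g o cdd).
assert (cY := Cn_on_slice 1 E E U _ Y g g o cdd).
assert (LU := locally_plane E U x X Y g (o x u)).
(* The inner [Derive] is known to be [dd] only at points of [U]; differentiating it again away from
   the origin requires [U] to contain a piece of the coordinate line there. *)
assert (near_l : forall u v, U (plane E x X Y u v) ->
  locally u (fun z => U (plane E x X Y z v))).
{ intros s t h. destruct (good_line E _ X U g o h) as [d hd]. exists d. intros z hz.
  rewrite plane_swap. rewrite plane_swap in h.
  replace (plane E x Y X t z) with (plus (plane E x X Y s t) (scal (z - s) X)).
  - apply hd, ball_R_0. exact hz.
  - rewrite plane_swap. unfold plane. rewrite <- plus_scal_add.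
    exact (f_equal (fun r => plus (plus x (scal t Y)) (scal r X)) (Rplus_minus s z)). }
assert (near_r : forall u v, U (plane E x X Y u v) ->
  locally v (fun z => U (plane E x X Y u z))).
{ intros s t h. destruct (good_line E _ Y U g o h) as [d hd]. exists d. intros z hz.
  replace (plane E x X Y s z) with (plus (plane E x X Y s t) (scal (z - t) Y)).
  - apply hd, ball_R_0. exact hz.
  - unfold plane. rewrite <- plus_scal_add.
    exact (f_equal (fun r => plus (plus x (scal s X)) (scal r Y)) (Rplus_minus t z)). }
assert (dl : forall u v, U (plane E x X Y u v) ->
  is_derive (fun z : R => Derive (fun t : R => f (plane E x X Y z t)) v) u
    (dd E (fun y => dd E f (y, Y)) (plane E x X Y u v, X))).
{ intros s t h.
  apply (is_derive_ext_loc (fun z : R => dd E f (plane E x X Y z t, Y))).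
  - generalize (near_l s t h). apply filter_imp. intros z hz. symmetry.
    apply is_derive_unique. now apply (is_derive_plane_r E U).
  - now apply (is_derive_plane_l E U (fun y => dd E f (y, Y))). }
assert (dr : forall u v, U (plane E x X Y u v) ->
  is_derive (fun z : R => Derive (fun t : R => f (plane E x X Y t z)) u) v
    (dd E (fun y => dd E f (y, X)) (plane E x X Y u v, Y))).
{ intros s t h.
  apply (is_derive_ext_loc (fun z : R => dd E f (plane E x X Y s z, X))).
  - generalize (near_r s t h). apply filter_imp. intros z hz. symmetry.
    apply is_derive_unique. now apply (is_derive_plane_l E U).
  - now apply (is_derive_plane_r E U (fun y => dd E f (y, X))). }
assert (u0 : U (plane E x X Y 0 0)) by now rewrite plane_0.
assert (cont : forall (G : E -> R), Cn_on 0 E Rtvs U G ->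
  continuity_2d_pt (fun u v => G (plane E x X Y u v)) 0 0).
{ intros G [cG _] eps.
  generalize (locally_plane E _ x X Y g (proj1 (filterlim_locally _ _) (cG x u) eps)).
  rewrite plane_0. intros [d hd]. exists d. exact hd. }
assert (e1 := is_derive_unique _ _ _ (dl 0 0 u0)).
assert (e2 := is_derive_unique _ _ _ (dr 0 0 u0)).
rewrite plane_0 in e1, e2.
etransitivity; [symmetry; exact e1|]. etransitivity; [|exact e2].
apply (Schwarz (fun u v => f (plane E x X Y u v)) 0 0).
- destruct LU as [d hd]. exists d. intros s t hs ht. specialize (hd s t hs ht).
  repeat split; eexists.
  + now apply (is_derive_plane_l E U).
  + now apply (is_derive_plane_r E U).
  + now apply dl.
  + now apply dr.
- apply continuity_2d_pt_ext_loc with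
    (fun u v => dd E (fun y => dd E f (y, Y)) (plane E x X Y u v, X)).
  + destruct LU as [d hd]. exists d. intros s t hs ht. symmetry. apply is_derive_unique. auto.
  + apply (cont (fun y => dd E (fun y => dd E f (y, Y)) (y, X))).
    apply Cn_on_slice; auto. now apply Cn_on_dd.
- apply continuity_2d_pt_ext_loc with
    (fun u v => dd E (fun y => dd E f (y, X)) (plane E x X Y u v, Y)).
  + destruct LU as [d hd]. exists d. intros s t hs ht. symmetry. apply is_derive_unique. auto.
  + apply (cont (fun y => dd E (fun y => dd E f (y, X)) (y, Y))).
    apply Cn_on_slice; auto. now apply Cn_on_dd.
Qed.

(** * Linear forms depending on a base point *)

Lemma linear_form_zero (E : tvs) (f : E -> R) : linear_form E f -> f zero = 0.
Proof.
intros h. assert (e : f zero = 1 * f zero + f zero).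
{ rewrite <- (h 1 (zero : E) (zero : E)). f_equal. symmetry.
  rewrite plus_zero_r. exact (scal_zero_r (1 : R_Ring)). }
lra.
Qed.

Lemma linear_form_plus (E : tvs) (f : E -> R) (x y : E) :
  linear_form E f -> f (plus x y) = f x + f y.
Proof.
intros h. assert (e : f (plus x y) = 1 * f x + f y); [|lra].
rewrite <- (h 1 x y). f_equal. apply (f_equal (fun w => plus w y)). symmetry. exact (scal_one x).
Qed.

Lemma linear_form_minus (E : tvs) (f : E -> R) (x y : E) :
  linear_form E f -> f (minus x y) = f x - f y.
Proof.
intros h. assert (e := linear_form_plus E f y (minus x y) h).
rewrite plus_minus_r in e. lra.
Qed.

Definition uncurry (E F : tvs) (l : E -> F -> R) : prodtvs E F -> R := fun p => l (fst p) (snd p).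

Lemma plus_scal_zero (E : tvs) (x : E) (h : R) : plus x (scal h (zero : E)) = x.
Proof.
transitivity (plus x (zero : E)); [|apply plus_zero_r].
f_equal. exact (scal_zero_r (h : R_Ring)).
Qed.

Lemma dd_uncurry_base (E F : tvs) (l : E -> F -> R) (x v : E) (w : F) :
  dd _ (uncurry E F l) ((x, w), (v, zero)) = dd E (fun y => l y w) (x, v).
Proof.
apply Derive_ext. intros h. unfold uncurry. simpl. f_equal. exact (plus_scal_zero F w h).
Qed.

Lemma is_derive_affine (a b t : R) : is_derive (fun h : R => h * a + b) t a.
Proof. auto_derive; [exact I | ring]. Qed.

Lemma dd_uncurry_fiber (E F : tvs) (l : E -> F -> R) (x : E) (w u : F) :
  linear_form F (l x) -> dd _ (uncurry E F l) ((x, w), (zero, u)) = l x u.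
Proof.
intros lin. apply is_derive_unique.
apply (is_derive_ext (fun h : R => h * l x u + l x w)).
- intros h. etransitivity.
  + symmetry. apply (lin h u w).
  + unfold uncurry. simpl. f_equal.
    * symmetry. exact (plus_scal_zero E x h).
    * apply plus_comm.
- apply is_derive_affine.
Qed.

(** The linearity identity holds at all base points of [U], so it can be differentiated in the base
    point. *)
Lemma linear_form_dd_slot (E F : tvs) (U : E -> Prop) (l : E -> F -> R) (x v : E) :
  good E -> good F -> open U -> (forall y, U y -> linear_form F (l y)) ->
  Cn_on 1 (prodtvs E F) Rtvs (fun p => U (fst p)) (uncurry E F l) -> U x ->
  linear_form F (fun w => dd _ (uncurry E F l) ((x, w), (v, zero))).
Proof.
intros gE gF o lin c u a w w'. rewrite !dd_uncurry_base.
apply is_dderive_dd.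
apply (is_dderive_ext_loc E Rtvs U (fun y => a * l y w + l y w')); auto.
{ intros y uy. symmetry. now apply lin. }
assert (d : forall w, is_dderive E Rtvs (fun y => l y w) x v (dd E (fun y => l y w) (x, v))).
{ intros w1. apply (Cn_on_is_dderive 0 E U); auto. now apply (Cn_on_slice 1 E F U (uncurry E F l)). }
apply is_dderive_plus; auto.
apply is_dderive_R.
apply (is_derive_scal (fun h : R => l (plus x (scal h v)) w)).
exact (proj1 (is_dderive_R _ _ _ _ _) (d w)).
Qed.

Lemma linear_form_dd_base (E F : tvs) (U : E -> Prop) (l : E -> F -> R) (x : E) (w : F) :
  good E -> good F -> open U ->
  Cn_on 1 (prodtvs E F) Rtvs (fun p => U (fst p)) (uncurry E F l) -> U x ->
  linear_form E (fun v => dd _ (uncurry E F l) ((x, w), (v, zero))).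
Proof.
intros gE gF o c u a v v'. rewrite !dd_uncurry_base.
apply (linear_form_dd E U); auto. now apply (Cn_on_slice 1 E F U (uncurry E F l)).
Qed.

(** Leibniz rule for a moving form on a moving vector: the joint direction [(v, u)] splits into a
    base part and a fibre part, and in the fibre a linear form is its own derivative. *)
Lemma is_dderive_uncurry (E F : tvs) (U : E -> Prop) (l : E -> F -> R) (x v : E) (Y : E -> F) (u : F) :
  good E -> good F -> open U -> linear_form F (l x) ->
  Cn_on 1 (prodtvs E F) Rtvs (fun p => U (fst p)) (uncurry E F l) -> U x ->
  is_dderive E F Y x v u ->
  is_dderive E Rtvs (fun y => l y (Y y)) x v
    (dd _ (uncurry E F l) ((x, Y x), (v, zero)) + l x u).
Proof.
intros gE gF o lin c ux d.
assert (g : good (prodtvs E F)) by now apply good_prodtvs.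
assert (o' := open_fst E F U o).
rewrite <- (dd_uncurry_fiber E F l x (Y x) u lin).
rewrite <- (linear_form_plus _ (fun q => dd _ (uncurry E F l) ((x, Y x), q))).
2: { apply (linear_form_dd (prodtvs E F) (fun p => U (fst p))); auto. }
replace (plus ((v, zero) : prodtvs E F) ((zero, u) : prodtvs E F)) with ((v, u) : prodtvs E F).
2: { apply injective_projections; symmetry; [exact (plus_zero_r v) | exact (plus_zero_l u)]. }
apply (is_dderive_comp E (prodtvs E F) (fun p => U (fst p)) (uncurry E F l) (fun y => (y, Y y))); auto.
apply is_dderive_pair; auto. apply is_dderive_id.
Qed.

(** * Exterior derivatives of one-forms *)

(** The invariant formula for constant fields, whose bracket vanishes. Using [dd] of the uncurried
    form rather than of slices makes smoothness in all arguments a consequence of that of [l]. *)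
Definition ext_derivative (E : tvs) (l : E -> E -> R) (x X Y : E) : R :=
  dd _ (uncurry E E l) ((x, Y), (X, zero)) - dd _ (uncurry E E l) ((x, X), (Y, zero)).

Lemma vector_field_const (E : tvs) (U : E -> Prop) (x X : E) :
  open U -> U x -> vector_field_near E U U x (fun _ => X).
Proof. intros o u. repeat split; auto. intros n. apply Cn_on_const. Qed.

Lemma vector_field_is_dderive (E : tvs) (U V : E -> Prop) (x v : E) (X : E -> E) :
  vector_field_near E U V x X -> exists u, is_dderive E E X x v u.
Proof.
intros [_ [hx [_ s]]]. destruct (s 1%nat) as [_ [dX [h _]]]. exists (dX (x, v)). now apply h.
Qed.

Section Forms.

Variables (E : bool -> tvs) (U : forall s, E s -> Prop).
Hypothesis gE : forall s, good (E s).
Hypothesis oU : forall s, open (U s).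

(** Constant fields determine [om] in one direction. In the other, the Leibniz rule adds [lam] of
    DY.X minus [lam] of DX.Y, which is exactly the bracket term. *)
Lemma is_ext_derivative_iff (lam : one_form E) (om : two_form E) :
  is_one_form E U lam ->
  (is_ext_derivative E U lam om <->
   forall s x X Y, U s x -> om s x X Y = ext_derivative (E s) (lam s) x X Y).
Proof.
intros hl. split.
- intros H s x X Y u. destruct (hl s) as [lin [sm _]].
  destruct (H s (U s) x (fun _ => X) (fun _ => Y)) as [a [b [c [ha [hb [[v [w [hv [hw hc]]]] e]]]]]];
    auto using vector_field_const.
  rewrite e. unfold ext_derivative. rewrite !dd_uncurry_base.
  rewrite (is_dderive_dd _ _ _ _ _ ha), (is_dderive_dd _ _ _ _ _ hb).
  (* Uniqueness of limits forces the bracket of the constant fields to vanish. *)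
  apply (is_dderive_unique _ _ _ _ _ _ _ (gE s) (is_dderive_const _ _ _ _ _)) in hv.
  apply (is_dderive_unique _ _ _ _ _ _ _ (gE s) (is_dderive_const _ _ _ _ _)) in hw.
  subst v w c. rewrite (linear_form_minus _ _ _ _ (lin x u)). ring.
- intros e s V x X Y hX hY. destruct (hl s) as [lin [sm _]].
  assert (hV := hX). destruct hV as [_ [vx [vu _]]]. assert (u := vu x vx).
  destruct (vector_field_is_dderive _ _ _ _ (X x) _ hY) as [yx hyx].
  destruct (vector_field_is_dderive _ _ _ _ (Y x) _ hX) as [xy hxy].
  do 2 eexists. exists (minus yx xy). split; [|split; [|split]].
  + apply (is_dderive_uncurry (E s) (E s) (U s)); eauto.
  + apply (is_dderive_uncurry (E s) (E s) (U s)); eauto.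
  + exists yx, xy. auto.
  + rewrite e, (linear_form_minus _ _ _ _ (lin x u)) by assumption. unfold ext_derivative. ring.
Qed.

Lemma is_ext_derivative_ext (lam : one_form E) :
  is_one_form E U lam -> is_ext_derivative E U lam (fun s => ext_derivative (E s) (lam s)).
Proof. intros h. now apply is_ext_derivative_iff. Qed.

Hypothesis symU : forall s x, U s x -> U s (opp x).

Lemma is_two_form_ext_derivative (lam : one_form E) (om : two_form E) :
  is_one_form E U lam -> is_ext_derivative E U lam om -> is_two_form E U om.
Proof.
intros hl hom. assert (e := proj1 (is_ext_derivative_iff lam om hl) hom).
intros s. destruct (hl s) as [lin [sm inv]].
assert (g2 : good (prodtvs (E s) (E s))) by auto using good_prodtvs.
assert (linX : forall x X, U s x -> linear_form (E s) (fun v => dd _ (uncurry (E s) (E s) (lam s)) ((x, X), (v, zero)))).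
{ intros x X u. apply (linear_form_dd_base (E s) (E s) (U s)); auto. }
assert (linY : forall x X, U s x -> linear_form (E s) (fun v => dd _ (uncurry (E s) (E s) (lam s)) ((x, v), (X, zero)))).
{ intros x X u. apply (linear_form_dd_slot (E s) (E s) (U s)); auto. }
split; [|split; [|split; [|split]]].
- intros x Y u a X X'. rewrite !e by assumption. unfold ext_derivative.
  rewrite (linX x Y u a X X'), (linY x Y u a X X'). ring.
- intros x X u a Y Y'. rewrite !e by assumption. unfold ext_derivative.
  rewrite (linX x X u a Y Y'), (linY x X u a Y Y'). ring.
- intros x X u. rewrite e by assumption. unfold ext_derivative. ring.
- intros n.
  apply (Cn_on_ext n _ Rtvs _ (fun p => ext_derivative (E s) (lam s) (fst p) (fst (snd p)) (snd (snd p)))).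
  + auto using good_prodtvs.
  + now apply open_fst.
  + intros [x [X Y]] u. symmetry. now apply e.
  + assert (sd := Cn_on_dd n _ _ _ g2 (open_fst _ (E s) _ (oU s)) (sm (S n))).
    apply Cn_on_minus.
    * apply (Cn_on_clinear n (prodtvs (E s) (prodtvs (E s) (E s))) (prodtvs (prodtvs (E s) (E s)) (prodtvs (E s) (E s))) Rtvs
        (fun p => ((fst p, snd (snd p)), (fst (snd p), zero))) (fun p => U s (fst (fst p)))); auto.
      repeat apply clinear_pair.
      -- apply clinear_fst.
      -- apply (clinear_comp _ (prodtvs (E s) (E s)) _ snd snd); apply clinear_snd.
      -- apply (clinear_comp _ (prodtvs (E s) (E s)) _ fst snd); [apply clinear_fst | apply clinear_snd].
      -- apply clinear_zero.
    * apply (Cn_on_clinear n (prodtvs (E s) (prodtvs (E s) (E s))) (prodtvs (prodtvs (E s) (E s)) (prodtvs (E s) (E s))) Rtvs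
        (fun p => ((fst p, fst (snd p)), (snd (snd p), zero))) (fun p => U s (fst (fst p)))); auto.
      repeat apply clinear_pair.
      -- apply clinear_fst.
      -- apply (clinear_comp _ (prodtvs (E s) (E s)) _ fst snd); [apply clinear_fst | apply clinear_snd].
      -- apply (clinear_comp _ (prodtvs (E s) (E s)) _ snd snd); apply clinear_snd.
      -- apply clinear_zero.
- intros x X Y u. rewrite !e by auto. unfold ext_derivative. rewrite !dd_uncurry_base.
  (* Negation maps the line [x + h X] to the line through [opp x] in direction [opp X]. Invariance
     of [lam] holds on [U] only, hence the comparison for small [h]. *)
  assert (k : forall X Y, dd (E s) (fun y => lam s y (opp Y)) (opp x, opp X) = dd (E s) (fun y => lam s y Y) (x, X)).
  { clear X Y. intros X Y. apply Derive_ext_loc. simpl.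
    generalize (good_line (E s) x X (U s) (gE s) (oU s) u). apply filter_imp. intros h uh.
    etransitivity; [|exact (inv (plus x (scal h X)) Y uh)]. f_equal.
    transitivity (plus (opp x) (opp (scal h X))).
    - f_equal. exact (scal_opp_r (h : R_Ring) X).
    - symmetry. apply (opp_plus x). }
  now rewrite !k.
Qed.

(** For arbitrary fields, the terms with derivatives of the fields cancel against the brackets by
    antisymmetry of [om], and the six second derivatives of [lam] cancel in pairs by symmetry. *)
Lemma is_closed_ext_derivative (lam : one_form E) (om : two_form E) :
  is_one_form E U lam -> is_ext_derivative E U lam om -> is_closed E U om.
Proof.
intros hl hom. assert (e := proj1 (is_ext_derivative_iff lam om hl) hom).
assert (tf := is_two_form_ext_derivative lam om hl hom).
intros s V x X Y Z hX hY hZ. destruct (hl s) as [lin [sm inv]].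
destruct (tf s) as [linX [linY [_ [sm2 _]]]].
assert (hV := hX). destruct hV as [_ [vx [vu _]]]. assert (u := vu x vx). clear vx vu.
(* In these names the first letter is the differentiated field and the second the direction: [yx] is
   DY.X. *)
destruct (vector_field_is_dderive _ _ _ _ (X x) _ hY) as [yx hyx].
destruct (vector_field_is_dderive _ _ _ _ (X x) _ hZ) as [zx hzx].
destruct (vector_field_is_dderive _ _ _ _ (Y x) _ hX) as [xy hxy].
destruct (vector_field_is_dderive _ _ _ _ (Y x) _ hZ) as [zy hzy].
destruct (vector_field_is_dderive _ _ _ _ (Z x) _ hX) as [xz hxz].
destruct (vector_field_is_dderive _ _ _ _ (Z x) _ hY) as [yz hyz].
assert (g2 : good (prodtvs (E s) (E s))) by auto using good_prodtvs.
set (S2 := fun W A B : E s => dd (E s) (fun y => dd (E s) (fun y => lam s y W) (y, A)) (x, B)).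
assert (slice : forall n W, Cn_on n (E s) Rtvs (U s) (fun y => lam s y W)).
{ intros n W. now apply (Cn_on_slice n (E s) (E s) (U s) (uncurry (E s) (E s) (lam s))). }
assert (slice' : forall n W A, Cn_on n (E s) Rtvs (U s) (fun y => dd (E s) (fun y => lam s y W) (y, A))).
{ intros n W A. apply Cn_on_slice; auto. now apply Cn_on_dd. }
assert (sym : forall W A B, S2 W A B = S2 W B A).
{ intros W A B. apply (dd_symmetric (E s) (U s) (fun y => lam s y W)); auto. }
(* The point enters [om y (A y) (A' y)] in three places. The base contributes second derivatives of
   [lam], and each of the two linear slots contributes [om] with the derivative of its field
   inserted. *)
assert (main : forall A A' B u1 u2, is_dderive (E s) (E s) A x B u1 -> is_dderive (E s) (E s) A' x B u2 ->
  is_dderive (E s) Rtvs (fun y => om s y (A y) (A' y)) x B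
    (S2 (A' x) (A x) B - S2 (A x) (A' x) B + (om s x u1 (A' x) + om s x (A x) u2))).
{ intros A A' B u1 u2 h1 h2.
  assert (d := is_dderive_pair _ _ _ _ _ _ _ _ _ h1 h2).
  set (f := uncurry (E s) (prodtvs (E s) (E s)) (fun y p => om s y (fst p) (snd p))).
  assert (sf : smooth_on (prodtvs (E s) (prodtvs (E s) (E s))) Rtvs (fun p => U s (fst p)) f) by exact sm2.
  assert (o2 := open_fst (E s) (prodtvs (E s) (E s)) _ (oU s)).
  assert (g3 : good (prodtvs (E s) (prodtvs (E s) (E s)))) by auto using good_prodtvs.
  assert (D := is_dderive_comp (E s) (prodtvs (E s) (prodtvs (E s) (E s))) (fun p => U s (fst p)) f
    (fun y => (y, (A y, A' y))) x B (B, (u1, u2)) g3 o2 (sf 1%nat) u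
    (is_dderive_pair _ _ _ _ _ _ _ _ _ (is_dderive_id _ x B) d)).
  unfold f at 1, uncurry in D. simpl in D.
  set (q := (x, (A x, A' x)) : prodtvs (E s) (prodtvs (E s) (E s))) in *.
  assert (L := linear_form_dd _ _ f q g3 o2 (sf 1%nat) u).
  assert (split : dd _ f (q, (B, (u1, u2))) =
    dd _ f (q, (B, zero)) + (dd _ f (q, (zero, (u1, zero))) + dd _ f (q, (zero, (zero, u2))))).
  { etransitivity; [|apply (f_equal (Rplus _)); exact (linear_form_plus _ _ (zero, (u1, zero)) (zero, (zero, u2)) L)].
    etransitivity; [|exact (linear_form_plus _ _ (B, zero) _ L)].
    apply (f_equal (fun r => dd _ f (q, r))).
    apply injective_projections; [|apply injective_projections]; symmetry; simpl.
    - etransitivity; [|exact (plus_zero_r B)]. exact (f_equal (plus B) (plus_zero_r (zero : E s))).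
    - etransitivity; [exact (plus_zero_l (plus u1 zero))|]. exact (plus_zero_r u1).
    - etransitivity; [exact (plus_zero_l (plus zero u2))|]. exact (plus_zero_l u2). }
  assert (e1 : dd _ f (q, (B, zero)) = S2 (A' x) (A x) B - S2 (A x) (A' x) B).
  { etransitivity.
    { exact (dd_uncurry_base (E s) (prodtvs (E s) (E s)) (fun y p => om s y (fst p) (snd p)) x B (A x, A' x)). }
    simpl.
    apply is_dderive_dd.
    apply (is_dderive_ext_loc _ _ (U s) (fun y => dd (E s) (fun y => lam s y (A' x)) (y, A x)
      - dd (E s) (fun y => lam s y (A x)) (y, A' x))); auto.
    - intros y uy. rewrite e by assumption. unfold ext_derivative. now rewrite !dd_uncurry_base.
    - apply is_dderive_minus.
      + apply (Cn_on_is_dderive 0 (E s) (U s) (fun y => dd (E s) (fun y => lam s y (A' x)) (y, A x))); auto.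
      + apply (Cn_on_is_dderive 0 (E s) (U s) (fun y => dd (E s) (fun y => lam s y (A x)) (y, A' x))); auto. }
  assert (e2 : dd _ f (q, (zero, (u1, zero))) = om s x u1 (A' x)).
  { apply is_dderive_dd, is_dderive_R.
    apply (is_derive_ext (fun h : R => h * om s x u1 (A' x) + om s x (A x) (A' x))).
    - intros h. etransitivity; [symmetry; apply (linX x (A' x) u h u1 (A x))|].
      unfold f, uncurry. simpl. f_equal.
      + symmetry. exact (plus_scal_zero (E s) x h).
      + apply plus_comm.
      + symmetry. exact (plus_scal_zero (E s) (A' x) h).
    - apply is_derive_affine. }
  assert (e3 : dd _ f (q, (zero, (zero, u2))) = om s x (A x) u2).
  { apply is_dderive_dd, is_dderive_R.
    apply (is_derive_ext (fun h : R => h * om s x (A x) u2 + om s x (A x) (A' x))).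
    - intros h. etransitivity; [symmetry; apply (linY x (A x) u h u2 (A' x))|].
      unfold f, uncurry. simpl. f_equal.
      + symmetry. exact (plus_scal_zero (E s) x h).
      + symmetry. exact (plus_scal_zero (E s) (A x) h).
      + apply plus_comm.
    - apply is_derive_affine. }
  rewrite e1, e2, e3 in split. rewrite <- split. exact D. }
do 3 eexists. exists (minus yx xy), (minus zx xz), (minus zy yz).
split; [apply main; eassumption|].
split; [apply main; eassumption|].
split; [apply main; eassumption|].
split; [exists yx, xy; auto|].
split; [exists zx, xz; auto|].
split; [exists zy, yz; auto|].
assert (anti : forall A B, om s x A B = - om s x B A).
{ intros A B. rewrite !e by assumption. unfold ext_derivative. ring. }
rewrite (linear_form_minus _ _ yx xy (linX x (Z x) u)).
rewrite (linear_form_minus _ _ zx xz (linX x (Y x) u)).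
rewrite (linear_form_minus _ _ zy yz (linX x (X x) u)).
rewrite (anti zx (Y x)), (anti zy (X x)), (anti yz (X x)).
rewrite (sym (Z x) (Y x) (X x)), (sym (Y x) (Z x) (X x)), (sym (X x) (Z x) (Y x)).
ring.
Qed.

End Forms.

(** * Calculus on loop spaces *)

(** Reduces a statement about all times to one period; it serves antiperiodic loops too, whenever
    the property ignores the sign. *)
Lemma periodic_induction (P : R -> Prop) :
  (forall t, P t <-> P (t + 1)) -> (forall t, 0 <= t <= 1 -> P t) -> forall t, P t.
Proof.
intros shift base.
assert (up : forall n t, P t -> P (t + INR n)).
{ induction n as [|n IH]; intros t h.
  - now rewrite Rplus_0_r.
  - rewrite S_INR, <- Rplus_assoc. now apply (proj1 (shift _)), IH. }
assert (down : forall n t, P (t + INR n) -> P t).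
{ induction n as [|n IH]; intros t h.
  - now rewrite Rplus_0_r in h.
  - rewrite S_INR, <- Rplus_assoc in h. now apply IH, (proj2 (shift _)). }
intros t. destruct (archimed t) as [a1 a2].
(* [up t] is the integer in [(t, t + 1]], so the shifted time lies in [[0, 1)]. The shift is then
   undone upwards or downwards according to the sign of the integer. *)
assert (b : P (t - IZR (Rdefinitions.up t) + 1)) by (apply base; lra).
set (m := (Rdefinitions.up t)) in *.
destruct (ZArith_dec.Z_le_gt_dec 0 m) as [l|l].
- replace t with ((t - IZR m) + INR (Z.to_nat m)).
  + now apply up, (proj2 (shift _)).
  + rewrite INR_IZR_INZ, Z2Nat.id by lia. ring.
- apply (down (Z.to_nat (- m))). apply (proj2 (shift _)).
  replace (t + INR (Z.to_nat (- m)) + 1) with (t - IZR m + 1); [exact b|].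
  rewrite INR_IZR_INZ, Z2Nat.id, opp_IZR by lia. ring.
Qed.

(** The boolean index lets statements about real and imaginary parts be proved once. *)
Definition coord (b : bool) (z : C) : R := if b then Re z else Im z.

Lemma coord_curve_derive (b : bool) (k : nat) (z : R -> C) (t : R) :
  coord b (curve_derive k z t) = Derive_n (fun t => coord b (z t)) k t.
Proof. now destruct b. Qed.

Lemma coord_ext (z w : C) : (forall b, coord b z = coord b w) -> z = w.
Proof. intros h. apply injective_projections; [apply (h true) | apply (h false)]. Qed.

Lemma coord_le_Cmod (b : bool) (z : C) : Rabs (coord b z) <= Cmod z.
Proof.
eapply Rle_trans; [|apply Rmax_Cmod].
destruct b; [apply Rmax_l | apply Rmax_r].
Qed.

Lemma smooth_coord (z : R -> C) (b : bool) (k : nat) (t : R) :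
  smooth_curve z -> ex_derive_n (fun t => coord b (z t)) k t.
Proof. intros h. destruct b; apply h. Qed.

Lemma coord_sgn (s b : bool) (z : C) : coord b (Cmult (sgn s) z) = sgn s * coord b z.
Proof. destruct b, z; simpl; ring. Qed.

Lemma coord_twist (s : bool) (z : loop s) (b : bool) (t : R) :
  coord b (z (t + 1)) = sgn s * coord b (z t).
Proof. now rewrite loop_twist, coord_sgn. Qed.

Definition loop_deriv (s : bool) (z : loop s) : loop s.
Proof.
refine (Loop s (curve_derive 1 z) _ _).
- intros k t. assert (h : forall b, ex_derive_n (fun t => coord b (curve_derive 1 z t)) k t).
  { intros b. destruct k as [|k]; [exact I|]. simpl.
    apply (ex_derive_ext (Derive_n (fun t => coord b (z t)) (k + 1))).
    - intros u. rewrite <- Derive_n_comp. apply Derive_n_ext. intros v. symmetry. now apply (coord_curve_derive b 1).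
    - replace (k + 1)%nat with (S k) by lia.
      exact (smooth_coord z b (S (S k)) t (loop_smooth s z)). }
  split; [apply (h true) | apply (h false)].
- intros t. apply coord_ext. intros b. rewrite coord_sgn, !coord_curve_derive.
  rewrite <- Derive_n_comp_trans.
  rewrite (Derive_n_ext _ (fun t => sgn s * coord b (z t))).
  + apply Derive_n_scal_l.
  + intros u. apply coord_twist.
Defined.

Lemma curve_derive_loop_deriv (s : bool) (z : loop s) (k : nat) (t : R) :
  curve_derive k (loop_deriv s z) t = curve_derive (S k) z t.
Proof.
apply coord_ext. intros b. rewrite !coord_curve_derive.
replace (S k) with (k + 1)%nat by lia. rewrite <- Derive_n_comp.
apply Derive_n_ext. intros u. exact (coord_curve_derive b 1 z u).
Qed.

Lemma continuous_coord (s : bool) (z : loop s) (b : bool) (t : R) :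
  continuous (fun t => coord b (z t)) t.
Proof.
apply (ex_derive_continuous (V := R_NormedModule)).
exact (smooth_coord z b 1 t (loop_smooth s z)).
Qed.

Lemma loop_bounded (s : bool) (z : loop s) : exists M, forall t, Cmod (z t) <= M.
Proof.
assert (B : forall b, exists M, forall t, Rabs (coord b (z t)) <= M).
{ intros b.
  destruct (bounded_continuity (K := R_AbsRing) (V := R_NormedModule) (fun t => coord b (z t)) 0 1) as [M hM].
  - intros t _. apply continuous_coord.
  - exists M. apply periodic_induction.
    (* The absolute value removes the sign of the twist, so the bound is 1-periodic even for
       antiperiodic loops. *)
    + intros t. rewrite coord_twist, Rabs_mult.
      replace (Rabs (sgn s)) with 1; [rewrite Rmult_1_l; tauto|].
      destruct s; simpl; [symmetry; apply Rabs_R1 | rewrite Rabs_left; lra].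
    + intros t ht. left. now apply hM. }
destruct (B true) as [M1 h1], (B false) as [M2 h2].
exists (sqrt 2 * Rmax M1 M2). intros t. eapply Rle_trans; [apply Cmod_2Rmax|].
apply Rmult_le_compat_l; [apply sqrt_pos|].
apply Rmax_case; [eapply Rle_trans; [apply (h1 t) | apply Rmax_l] | eapply Rle_trans; [apply (h2 t) | apply Rmax_r]].
Qed.

Lemma curve_derive_bounded (s : bool) (k : nat) (z : loop s) :
  exists M, forall t, Cmod (curve_derive k z t) <= M.
Proof.
revert z. induction k as [|k IH]; intros z.
- destruct (loop_bounded s z) as [M h]. exists M. intros t.
  replace (curve_derive 0 z t) with (z t); [apply h|]. apply coord_ext. now intros [|].
- destruct (IH (loop_deriv s z)) as [M h]. exists M. intros t.
  rewrite <- curve_derive_loop_deriv. apply h.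
Qed.

(** A ball of the loop topology restricts only finitely many derivatives, so bounds up to a fixed
    order are what its estimates use. *)
Lemma curve_derive_bounded_upto (s : bool) (N : nat) (z : loop s) :
  exists M, 0 <= M /\ forall k t, (k < N)%nat -> Cmod (curve_derive k z t) <= M.
Proof.
induction N as [|N [M [M0 h]]].
- exists 0. split; [lra|]. intros k t hk. lia.
- destruct (curve_derive_bounded s N z) as [M' h']. exists (Rmax M M'). split.
  + eapply Rle_trans; [exact M0 | apply Rmax_l].
  + intros k t hk. destruct (Nat.eq_dec k N) as [->|ne].
    * eapply Rle_trans; [apply h' | apply Rmax_r].
    * eapply Rle_trans; [apply h; lia | apply Rmax_l].
Qed.

Lemma curve_derive_plus_scal (s : bool) (y w : loop_tvs s) (a : R) (k : nat) (t : R) :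
  curve_derive k (plus y (scal a w) : loop s) t =
  Cplus (curve_derive k (y : loop s) t) (Cmult a (curve_derive k (w : loop s) t)).
Proof.
assert (e : forall b, coord b (curve_derive k (plus y (scal a w) : loop s) t) =
  coord b (curve_derive k (y : loop s) t) + a * coord b (curve_derive k (w : loop s) t)).
{ intros b. rewrite !coord_curve_derive.
  rewrite (Derive_n_ext _ (fun t => coord b ((y : loop s) t) + a * coord b ((w : loop s) t))).
  2: { intros u. now destruct b. }
  rewrite Derive_n_plus, Derive_n_scal_l; [reflexivity| |];
    exists (mkposreal 1 Rlt_0_1); intros u _ j _.
  - apply smooth_coord, loop_smooth.
  - apply ex_derive_n_scal_l, smooth_coord, loop_smooth. }
apply coord_ext. intros b. rewrite e.
destruct b; simpl; unfold Re, Im; ring.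
Qed.

Lemma good_loop (s : bool) : good (loop_tvs s).
Proof.
split.
- intros x y h. apply loop_ext. intros t. apply coord_ext. intros b.
  apply cond_eq. intros e he.
  assert (k := h (mkposreal e he) 0%nat t). simpl in k.
  eapply Rle_lt_trans; [|apply k; lra].
  eapply Rle_trans; [|apply (coord_le_Cmod b)]. right. f_equal. destruct b; simpl; reflexivity.
- intros x v eps.
  (* [INR k * eps < 1] forces [k < N], so only derivatives of [v] below order [N] matter. *)
  destruct (INR_unbounded (/ eps)) as [N hN].
  destruct (curve_derive_bounded_upto s N v) as [M [M0 hM]].
  assert (q := cond_pos eps).
  assert (a : 0 < eps / (2 + M)) by (apply Rdiv_lt_0_compat; lra).
  assert (hd : 0 < Rmin (Rmin 1 eps) (eps / (2 + M))) by (repeat apply Rmin_pos; lra).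
  (* [d <= eps] ensures that the orders tested at radius [eps] are also tested at radius [d];
     [d <= 1] gives [Cmod cw <= M + 1]; the last bound gives [d + d * (M + 1) <= eps]. *)
  exists (mkposreal _ hd). simpl. set (d := Rmin (Rmin 1 eps) (eps / (2 + M))) in *.
  assert (d1 : d <= 1) by (eapply Rle_trans; [apply Rmin_l | apply Rmin_l]).
  assert (d2 : d <= eps) by (eapply Rle_trans; [apply Rmin_l | apply Rmin_r]).
  assert (d3 : d * (2 + M) <= eps).
  { apply Rle_trans with (eps / (2 + M) * (2 + M)).
    - apply Rmult_le_compat_r; [lra | apply Rmin_r].
    - right. field. lra. }
  intros t y w ht hy hw k tau hk. rewrite curve_derive_plus_scal.
  assert (pk := pos_INR k).
  assert (hkd : INR k * d < 1) by nra.
  assert (b1 := hy k tau hkd). assert (b2 := hw k tau hkd).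
  assert (kN : (k < N)%nat).
  { apply INR_lt. eapply Rlt_trans; [|exact hN].
    apply Rmult_lt_reg_r with eps; [lra|]. rewrite Rinv_l; lra. }
  assert (b3 := hM k tau kN).
  set (cx := curve_derive k (x : loop s) tau) in *.
  set (cy := curve_derive k (y : loop s) tau) in *.
  set (cv := curve_derive k (v : loop s) tau) in *.
  set (cw := curve_derive k (w : loop s) tau) in *.
  replace (Cminus cx (Cplus cy (Cmult t cw))) with
    (Cplus (Cminus cx cy) (Copp (Cmult t cw))) by ring.
  eapply Rle_lt_trans; [apply Cmod_triangle|].
  rewrite Cmod_opp, Cmod_mult, Cmod_R.
  assert (Cmod cw <= M + 1).
  { replace cw with (Cplus cv (Copp (Cminus cv cw))) by ring.
    eapply Rle_trans; [apply Cmod_triangle|]. rewrite Cmod_opp. lra. }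
  assert (Rabs t * Cmod cw <= d * (M + 1)).
  { apply Rmult_le_compat; [apply Rabs_pos | apply Cmod_ge_0 | lra | lra]. }
  lra.
Qed.

Lemma clinear_loop_deriv (s : bool) : clinear (loop_tvs s) (loop_tvs s) (loop_deriv s).
Proof.
split.
- intros x v h. apply loop_ext. intros t. etransitivity; [exact (curve_derive_plus_scal s x v h 1 t)|].
  apply coord_ext. intros b. destruct b; simpl; unfold Re, Im; simpl; ring.
- intros x. apply filterlim_locally. intros eps.
  assert (q := cond_pos eps).
  (* The reciprocal of this radius is [/ eps + 1]: the smaller ball controls one more order, which
     pays for the differentiation. *)
  assert (a : 0 < eps / (1 + eps)) by (apply Rdiv_lt_0_compat; lra).
  exists (mkposreal _ a). intros y hy k t hk.
  rewrite !curve_derive_loop_deriv.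
  assert (e : eps / (1 + eps) * (1 + eps) = eps) by (field; lra).
  eapply Rlt_le_trans; [apply (hy (S k) t)|].
  + simpl pos. rewrite S_INR. assert (pk := pos_INR k).
    apply Rmult_lt_reg_r with (1 + eps); [lra|]. rewrite Rmult_assoc, e. lra.
  + simpl pos. set (r := eps / (1 + eps)) in *. nra.
Qed.

(** The differential at [(z, t)] along [(w, r)] is [w t + r * z' t]. As [z'] is the continuous
    linear image [loop_deriv s z], this is again built from evaluation, and the induction closes. *)
Lemma Cn_on_eval (n : nat) (s b : bool) :
  Cn_on n (prodtvs (loop_tvs s) Rtvs) Rtvs (fun _ => True)
    (fun p => coord b ((fst p : loop s) (snd p))).
Proof.
(* Every order asks for continuity, so it is proved before the induction: [y u - z t] is split at
   [z u], and the ball bounds [y u - z u] uniformly in [u]. *)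
assert (cont : forall p : prodtvs (loop_tvs s) Rtvs,
  continuous (U := Rtvs) (fun p : prodtvs (loop_tvs s) Rtvs => coord b ((fst p : loop s) (snd p))) p).
{ intros [z t]. apply filterlim_locally. intros eps.
  destruct (proj1 (filterlim_locally _ _) (continuous_coord s z b t) (pos_div_2 eps)) as [d hd].
  assert (r : 0 < Rmin d (eps / 2)) by (apply Rmin_pos; [apply cond_pos | exact (cond_pos (pos_div_2 eps))]).
  assert (sl := Rmin_l d (eps / 2)). assert (sr := Rmin_r d (eps / 2)).
  exists (mkposreal _ r). intros [y u] [hy hu]. simpl in hy, hu. apply ball_R. simpl.
  assert (h1 : Rabs (coord b ((z : loop s) u) - coord b ((z : loop s) t)) < eps / 2).
  { apply hd. eapply ball_le; [exact sl|]. exact hu. }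
  assert (h2 := hy 0%nat u ltac:(simpl; lra)).
  assert (h3 := Rle_lt_trans _ _ _ (coord_le_Cmod b _) h2).
  replace (coord b (Cminus (curve_derive 0 (z : loop s) u) (curve_derive 0 (y : loop s) u)))
    with (coord b ((z : loop s) u) - coord b ((y : loop s) u)) in h3 by (destruct b; reflexivity).
  replace (coord b ((y : loop s) u) - coord b ((z : loop s) t)) with
    (- (coord b ((z : loop s) u) - coord b ((y : loop s) u)) +
     (coord b ((z : loop s) u) - coord b ((z : loop s) t))) by ring.
  eapply Rle_lt_trans; [apply Rabs_triang|]. rewrite Rabs_Ropp. lra. }
induction n as [|n IH]; split; auto.
exists (fun q => coord b ((fst (snd q) : loop s) (snd (fst q))) +
   snd (snd q) * coord b ((loop_deriv s (fst (fst q)) : loop s) (snd (fst q)))).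
split.
- intros [z t] [w r] _. simpl. apply is_dderive_R. simpl.
  assert (dz : forall (y : loop s) u, is_derive (fun u => coord b (y u)) u (coord b (loop_deriv s y u))).
  { intros y u. replace (coord b (loop_deriv s y u)) with (Derive (fun u => coord b (y u)) u).
    - apply Derive_correct. exact (smooth_coord y b 1 u (loop_smooth s y)).
    - symmetry. exact (coord_curve_derive b 1 y u). }
  assert (line : is_derive (fun h : R => t + h * r) 0 r) by (auto_derive; [exact I | ring]).
  assert (e : @eq R t (t + 0 * r)) by (symmetry; rewrite Rmult_0_l; apply Rplus_0_r).
  assert (D1 := is_derive_comp (V := R_NormedModule) (fun u => coord b ((z : loop s) u)) (fun h : R => t + h * r) 0 _ _ (dz z _) line).
  assert (D2 := is_derive_comp (V := R_NormedModule) (fun u => coord b ((w : loop s) u)) (fun h : R => t + h * r) 0 _ _ (dz w _) line).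
  assert (D3 := is_derive_mult (fun h : R => h) _ 0 1 _ (is_derive_id (K := R_AbsRing) 0) D2 Rmult_comm).
  assert (D := is_derive_plus _ _ _ _ _ D1 D3).
  rewrite <- e in D.
  match goal with |- is_derive _ _ ?l => match type of D with is_derive _ _ ?l' =>
    replace l with l' end end.
  + revert D. apply is_derive_ext. intros h. destruct b; reflexivity.
  + change (r * coord b (loop_deriv s z t) + (1 * coord b ((w : loop s) (t + 0 * r)) + 0 * (r * coord b (loop_deriv s w t)))
      = coord b ((w : loop s) t) + r * coord b (loop_deriv s z t)).
    rewrite <- e. ring.
- apply (Cn_on_plus n (prodtvs (prodtvs (loop_tvs s) Rtvs) (prodtvs (loop_tvs s) Rtvs))).
  + apply (Cn_on_clinear n _ (prodtvs (loop_tvs s) Rtvs) Rtvs (fun q => (fst (snd q), snd (fst q))) (fun _ => True)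
      (fun p => coord b ((fst p : loop s) (snd p)))); auto.
    apply clinear_pair.
    * apply (clinear_comp _ (prodtvs (loop_tvs s) Rtvs) _ fst snd); [apply clinear_fst | apply clinear_snd].
    * apply (clinear_comp _ (prodtvs (loop_tvs s) Rtvs) _ snd fst); [apply clinear_snd | apply clinear_fst].
  + apply Cn_on_mult.
    * apply (Cn_on_of_clinear n _ Rtvs).
      apply (clinear_comp _ (prodtvs (loop_tvs s) Rtvs) _ snd snd); apply clinear_snd.
    * apply (Cn_on_clinear n _ (prodtvs (loop_tvs s) Rtvs) Rtvs (fun q => (loop_deriv s (fst (fst q)), snd (fst q))) (fun _ => True)
        (fun p => coord b ((fst p : loop s) (snd p)))); auto.
      apply clinear_pair.
      -- apply (clinear_comp _ (loop_tvs s) (loop_tvs s) (loop_deriv s)); [apply clinear_loop_deriv|].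
         apply (clinear_comp _ (prodtvs (loop_tvs s) Rtvs) _ fst fst); apply clinear_fst.
      -- apply (clinear_comp _ (prodtvs (loop_tvs s) Rtvs) _ snd fst); [apply clinear_snd | apply clinear_fst].
Qed.

(** * The forms [Lambda] and [Theta] *)

Lemma RInt_linear (f g : R -> R) (a u v : R) :
  ex_RInt f u v -> ex_RInt g u v ->
  RInt (fun t => a * f t + g t) u v = a * RInt f u v + RInt g u v.
Proof.
intros hf hg.
etransitivity.
- exact (RInt_plus (V := R_CompleteNormedModule) (fun t => a * f t) g u v (ex_RInt_scal (V := R_NormedModule) f u v a hf) hg).
- apply (f_equal (fun r => r + RInt g u v)). exact (RInt_scal (V := R_CompleteNormedModule) f u v a hf).
Qed.

Lemma RInt_pos_of_continuous (f : R -> R) (t0 : R) :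
  (forall t, continuous f t) -> (forall t, 0 <= f t) -> 0 <= t0 <= 1 -> 0 < f t0 ->
  0 < RInt f 0 1.
Proof.
intros c p h0 h.
destruct (proj1 (filterlim_locally _ _) (c t0) (mkposreal _ h)) as [d hd].
(* Clipping keeps the interval in [[0, 1]] when [t0] is near an endpoint. Inside it [f] differs from
   [f t0] by less than [f t0], hence is positive. *)
set (a := Rmax 0 (t0 - d / 2)). set (b := Rmin 1 (t0 + d / 2)).
assert (q := cond_pos d).
assert (ha : 0 <= a /\ t0 - d / 2 <= a) by (split; [apply Rmax_l | apply Rmax_r]).
assert (hb : b <= 1 /\ b <= t0 + d / 2) by (split; [apply Rmin_l | apply Rmin_r]).
assert (ab : a < b).
{ unfold a, b, Rmax, Rmin. destruct (Rle_dec 0 (t0 - d / 2)), (Rle_dec 1 (t0 + d / 2)); lra. }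
assert (i : forall u v, ex_RInt f u v).
{ intros u v. apply (ex_RInt_continuous (V := R_CompleteNormedModule)). auto. }
rewrite <- (RInt_Chasles f 0 a 1) by auto. rewrite <- (RInt_Chasles f a b 1) by auto.
assert (0 <= RInt f 0 a) by (apply RInt_ge_0; auto; tauto).
assert (0 <= RInt f b 1) by (apply RInt_ge_0; auto; tauto).
assert (0 < RInt f a b).
{ apply RInt_gt_0; auto.
  intros t ht. assert (k : ball (f t0) (f t0) (f t)).
  { apply hd. apply ball_R. apply Rabs_def1; lra. }
  apply (proj1 (ball_R _ _ _)) in k. apply Rabs_def2 in k. lra. }
change (0 < RInt f 0 a + (RInt f a b + RInt f b 1)). lra.
Qed.

Lemma sgn_sqr (s : bool) : Cmult (sgn s) (sgn s) = RtoC 1.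
Proof. destruct s; apply injective_projections; simpl; ring. Qed.

Lemma loop_nonzero (s : bool) (z : loop_tvs s) :
  z <> zero -> exists t, 0 <= t <= 1 /\ (z : loop s) t <> RtoC 0.
Proof.
intros nz. apply NNPP. intros H. apply nz. apply loop_ext.
apply periodic_induction.
- intros t. rewrite !loop_twist. split; intros e.
  + now rewrite e.
  (* The twist is an involution, so vanishing also propagates backwards in time. *)
  + assert (m : forall w : C, Cmult (sgn s) (Cmult (sgn s) w) = w).
    { intros w. rewrite Cmult_assoc, sgn_sqr. apply Cmult_1_l. }
    now rewrite <- (m ((z : loop s) t)), e, m.
- intros t ht. apply NNPP. intros ne. apply H. exists t. auto.
Qed.

Lemma Cn_on_eval_comp n (s b : bool) (E : tvs) (U : E -> Prop) (L : E -> loop_tvs s) (T : E -> R) :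
  Cn_on n E (loop_tvs s) U L -> Cn_on n E Rtvs U T ->
  Cn_on n E Rtvs U (fun x => coord b ((L x : loop s) (T x))).
Proof.
intros hL hT.
apply (Cn_on_comp n E (prodtvs (loop_tvs s) Rtvs) U (fun _ => True)
  (fun p => coord b ((fst p : loop s) (snd p))) (fun x => (L x, T x))); auto.
- apply good_prodtvs; [apply good_loop | apply good_Rtvs].
- apply open_full.
- now apply Cn_on_pair.
- apply Cn_on_eval.
Qed.

Lemma continuous_inner (s : bool) (z w : loop s) (t : R) :
  continuous (fun t => Re (z t) * Re (w t) + Im (z t) * Im (w t)) t.
Proof.
apply (continuous_plus (V := R_NormedModule)
  (fun t => Re (z t) * Re (w t)) (fun t => Im (z t) * Im (w t))).
- apply (continuous_mult (K := R_AbsRing) (fun t => Re (z t)) (fun t => Re (w t)));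
    [apply (continuous_coord s z true) | apply (continuous_coord s w true)].
- apply (continuous_mult (K := R_AbsRing) (fun t => Im (z t)) (fun t => Im (w t)));
    [apply (continuous_coord s z false) | apply (continuous_coord s w false)].
Qed.

Lemma ex_RInt_inner (s : bool) (z w : loop s) (a b : R) :
  ex_RInt (fun t => Re (z t) * Re (w t) + Im (z t) * Im (w t)) a b.
Proof.
apply (ex_RInt_continuous (V := R_CompleteNormedModule)). intros. apply continuous_inner.
Qed.

Lemma linear_form_inner (s : bool) (z : loop s) :
  linear_form (loop_tvs s) (fun w => inner z (w : loop s)).
Proof.
intros a x y. unfold inner. rewrite <- RInt_linear; try apply ex_RInt_inner.
apply RInt_ext. intros t _. simpl. unfold Re, Im. simpl. ring.
Qed.

Lemma inner_comm (z w : R -> C) : inner z w = inner w z.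
Proof.
apply RInt_ext. intros t _. now rewrite (Rmult_comm (Re (z t))), (Rmult_comm (Im (z t))).
Qed.

Lemma inner_pos (s : bool) (z : loop_tvs s) : z <> zero -> 0 < inner (z : loop s) (z : loop s).
Proof.
intros nz. destruct (loop_nonzero s z nz) as [t [ht ne]].
apply RInt_pos_of_continuous with t; auto.
- intros u. apply continuous_inner.
- intros u. nra.
- destruct (Req_dec (Re ((z : loop s) t)) 0) as [r|r], (Req_dec (Im ((z : loop s) t)) 0) as [i|i]; try nra.
  contradiction ne. now apply injective_projections.
Qed.

Lemma Cn_on_inner n (s : bool) (E : tvs) (U : E -> Prop) (L M : E -> loop_tvs s) :
  good E -> open U ->
  Cn_on n E (loop_tvs s) U L -> Cn_on n E (loop_tvs s) U M ->
  Cn_on n E Rtvs U (fun x => inner (L x : loop s) (M x : loop s)).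
Proof.
intros g o hL hM.
apply (Cn_on_RInt n E U (fun p => coord true ((L (fst p) : loop s) (snd p)) * coord true ((M (fst p) : loop s) (snd p))
  + coord false ((L (fst p) : loop s) (snd p)) * coord false ((M (fst p) : loop s) (snd p)))); auto.
apply Cn_on_plus; apply Cn_on_mult; apply Cn_on_eval_comp.
1, 3, 5, 7: now apply Cn_on_fst.
all: apply Cn_on_of_clinear, clinear_snd.
Qed.

Lemma open_preimage (E F : tvs) (L : E -> F) (U : F -> Prop) :
  (forall x, continuous L x) -> open U -> open (fun x => U (L x)).
Proof. intros c o x u. exact (c x _ (o _ u)). Qed.

Lemma opp_loop_eval (s : bool) (z : loop_tvs s) (t : R) :
  (opp z : loop s) t = Copp ((z : loop s) t).
Proof. apply injective_projections; simpl; unfold Re, Im; ring. Qed.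

Lemma loops_in_opp (Q : C -> Prop) (s : bool) (z : loop_tvs s) : loops_in Q s z -> loops_in Q s (opp z).
Proof.
intros [nz hQ]. split.
- intros e. apply nz. rewrite <- (opp_opp z). etransitivity; [apply f_equal; exact e|]. apply opp_zero.
- intros t. rewrite opp_loop_eval.
  replace (Cmult (Copp ((z : loop s) t)) (Copp ((z : loop s) t))) with (Cmult ((z : loop s) t) ((z : loop s) t)) by ring.
  apply hQ.
Qed.

(** Evaluation at one time where [z] is nonzero separates nearby loops from zero. The condition on
    [Q] concerns all times: the tube lemma secures one period, and the square of a loop is
    1-periodic for both signs. *)
Lemma open_loops_in (Q : C -> Prop) (s : bool) : open Q -> open (loops_in Q s).
Proof.
intros o z [nz hQ]. apply filter_and.
- destruct (loop_nonzero s z nz) as [t [_ ne]].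
  assert (p : 0 < Cmod ((z : loop s) t)) by now apply Cmod_gt_0.
  exists (mkposreal _ p). intros y hy e. subst y.
  assert (k : Cmod (Cminus (curve_derive 0 (z : loop s) t) (curve_derive 0 (loop_zero s) t)) < Cmod ((z : loop s) t)).
  { apply (hy 0%nat t). simpl. lra. }
  replace (Cminus (curve_derive 0 (z : loop s) t) (curve_derive 0 (loop_zero s) t)) with ((z : loop s) t) in k.
  + lra.
  + apply injective_projections; simpl; unfold Re, Im; ring.
- assert (T : locally z (fun y => forall t, 0 <= t <= 1 -> Q (Cmult ((y : loop s) t) ((y : loop s) t)))).
  { apply (tube_lemma (loop_tvs s) (fun y t => Q (Cmult ((y : loop s) t) ((y : loop s) t)))).
    intros t _.
    assert (ev : forall b, Cn_on 0 (prodtvs (loop_tvs s) Rtvs) Rtvs (fun _ => True)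
      (fun p => coord b ((fst p : loop s) (snd p)))) by (intros b; apply Cn_on_eval).
    assert (sq : Cn_on 0 (prodtvs (loop_tvs s) Rtvs) Ctvs (fun _ => True)
      (fun p => Cmult ((fst p : loop s) (snd p)) ((fst p : loop s) (snd p)))).
    { apply (Cn_on_pair 0 _ Rtvs Rtvs).
      - apply Cn_on_minus; apply Cn_on_mult; first [apply (ev true) | apply (ev false)].
      - apply Cn_on_plus; apply Cn_on_mult; first [apply (ev true) | apply (ev false)]. }
    destruct (Cn_on_continuous _ _ _ _ _ (z, t) sq I _ (o _ (hQ t))) as [d hd].
    exists d. intros y u hy hu. apply (hd (y, u)). split; [exact hy | exact hu]. }
  revert T. apply filter_imp. intros y hy.
  apply (periodic_induction (fun t => Q (Cmult ((y : loop s) t) ((y : loop s) t)))); auto.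
  intros t. rewrite loop_twist.
  replace (Cmult (Cmult (sgn s) ((y : loop s) t)) (Cmult (sgn s) ((y : loop s) t)))
    with (Cmult (Cmult (sgn s) (sgn s)) (Cmult ((y : loop s) t) ((y : loop s) t))) by ring.
  rewrite sgn_sqr, Cmult_1_l. tauto.
Qed.

(** The substitution [sigma = t * u] moves the time from the limit of integration into the
    integrand, so that [Cn_on_RInt] applies; [inner z z] removes the square root of the norm. *)
Lemma time_change_eq (s : bool) (z : loop s) (t : R) :
  time_change z t = / inner z z * (t * RInt (fun u => Re (z (t * u)) * Re (z (t * u)) + Im (z (t * u)) * Im (z (t * u))) 0 1).
Proof.
unfold time_change. f_equal.
- f_equal. unfold L2norm. apply pow2_sqrt.
  apply RInt_ge_0; [lra | apply ex_RInt_inner | intros; nra].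
- set (f := fun t => Re (z t) * Re (z t) + Im (z t) * Im (z t)).
  transitivity (RInt f 0 t).
  + apply RInt_ext. intros u _. unfold Cmod, f. rewrite pow2_sqrt; [simpl; unfold Re, Im; ring | nra].
  + assert (e := RInt_comp_lin (V := R_CompleteNormedModule) f t 0 0 1).
    replace (t * 0 + 0) with 0 in e by ring. replace (t * 1 + 0) with t in e by ring.
    rewrite <- e by apply ex_RInt_inner.
    etransitivity.
    * apply (RInt_scal (V := R_CompleteNormedModule) (fun u => f (t * u + 0)) 0 1 t).
      apply (ex_RInt_continuous (V := R_CompleteNormedModule)). intros u _.
      apply (continuous_comp (fun u => t * u + 0) f); [|apply continuous_inner].
      apply (ex_derive_continuous (V := R_NormedModule)). auto_derive. exact I.
    * apply f_equal. apply RInt_ext. intros u _. now rewrite Rplus_0_r.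
Qed.

Lemma Cn_on_time_change n (s : bool) (E : tvs) (U : E -> Prop) (L : E -> loop_tvs s) (T : E -> R) :
  good E -> open U -> (forall x, U x -> L x <> zero) ->
  Cn_on n E (loop_tvs s) U L -> Cn_on n E Rtvs U T ->
  Cn_on n E Rtvs U (fun x => time_change (L x : loop s) (T x)).
Proof.
intros g o nz hL hT.
apply (Cn_on_ext n E Rtvs U (fun x => / inner (L x : loop s) (L x : loop s) *
  (T x * RInt (fun u => Re ((L x : loop s) (T x * u)) * Re ((L x : loop s) (T x * u))
     + Im ((L x : loop s) (T x * u)) * Im ((L x : loop s) (T x * u))) 0 1))); auto.
{ intros x _. symmetry. apply time_change_eq. }
apply Cn_on_mult; [|apply Cn_on_mult; auto].
- apply Cn_on_inv; [|now apply Cn_on_inner].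
  intros x u. apply Rgt_not_eq, inner_pos. auto.
- apply (Cn_on_RInt n E U (fun p =>
     coord true ((L (fst p) : loop s) (T (fst p) * snd p)) * coord true ((L (fst p) : loop s) (T (fst p) * snd p))
     + coord false ((L (fst p) : loop s) (T (fst p) * snd p)) * coord false ((L (fst p) : loop s) (T (fst p) * snd p)))); auto.
  assert (ev : forall b, Cn_on n (prodtvs E Rtvs) Rtvs (fun p => U (fst p))
    (fun p => coord b ((L (fst p) : loop s) (T (fst p) * snd p)))).
  { intros b. apply (Cn_on_eval_comp n s b (prodtvs E Rtvs) _ (fun p => L (fst p)) (fun p => T (fst p) * snd p)).
    - now apply Cn_on_fst.
    - apply (Cn_on_mult n (prodtvs E Rtvs)).
      + now apply (Cn_on_fst n E Rtvs Rtvs U T).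
      + apply (Cn_on_of_clinear n (prodtvs E Rtvs) Rtvs), clinear_snd. }
  apply Cn_on_plus; apply Cn_on_mult; apply ev.
Qed.

(** * The magnetic one-form *)

Definition Theta_integrand (theta : R -> C -> C -> R) (s : bool)
    (q : prodtvs (prodtvs (loop_tvs s) (loop_tvs s)) Rtvs) : R :=
  vartheta theta (time_change (fst (fst q) : loop s) (snd q))
    ((fst (fst q) : loop s) (snd q)) ((snd (fst q) : loop s) (snd q)).

Lemma Cn_on_Theta_integrand n (Q : C -> Prop) (theta : R -> C -> C -> R) (s : bool) :
  open Q -> periodic_family Q theta ->
  Cn_on n (prodtvs (prodtvs (loop_tvs s) (loop_tvs s)) Rtvs) Rtvs
    (fun q => loops_in Q s (fst (fst q))) (Theta_integrand theta s).
Proof.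
intros o [_ [sm _]].
set (G := prodtvs (prodtvs (loop_tvs s) (loop_tvs s)) Rtvs).
set (F := prodtvs Rtvs (prodtvs Ctvs Ctvs)).
assert (gG : good G) by (unfold G; auto using good_prodtvs, good_Rtvs, good_loop).
assert (gF : good F) by (unfold F, Ctvs; auto using good_prodtvs, good_Rtvs).
assert (oG : open (fun q : G => loops_in Q s (fst (fst q)))).
{ apply (open_fst (prodtvs (loop_tvs s) (loop_tvs s)) Rtvs (fun p => loops_in Q s (fst p))).
  now apply open_fst, open_loops_in. }
assert (Lz : clinear G (loop_tvs s) (fun q => fst (fst q))).
{ apply (clinear_comp _ (prodtvs (loop_tvs s) (loop_tvs s)) _ fst fst); apply clinear_fst. }
assert (Lx : clinear G (loop_tvs s) (fun q => snd (fst q))).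
{ apply (clinear_comp _ (prodtvs (loop_tvs s) (loop_tvs s)) _ snd fst); [apply clinear_snd | apply clinear_fst]. }
assert (Lt : clinear G Rtvs (fun q => snd q)) by apply clinear_snd.
assert (ez : forall b, Cn_on n G Rtvs (fun q => loops_in Q s (fst (fst q)))
  (fun q => coord b ((fst (fst q) : loop s) (snd q)))).
{ intros b. apply (Cn_on_eval_comp n s b G _ (fun q => fst (fst q)) (fun q => snd q)); now apply Cn_on_of_clinear. }
assert (ex : forall b, Cn_on n G Rtvs (fun q => loops_in Q s (fst (fst q)))
  (fun q => coord b ((snd (fst q) : loop s) (snd q)))).
{ intros b. apply (Cn_on_eval_comp n s b G _ (fun q => snd (fst q)) (fun q => snd q)); now apply Cn_on_of_clinear. }
apply (Cn_on_comp n G F (fun q => loops_in Q s (fst (fst q))) (fun p => Q (fst (snd p)))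
  (fun p => theta (fst p) (fst (snd p)) (snd (snd p)))
  (fun q => (time_change (fst (fst q) : loop s) (snd q),
    (Cmult ((fst (fst q) : loop s) (snd q)) ((fst (fst q) : loop s) (snd q)),
     Cmult 2 (Cmult ((fst (fst q) : loop s) (snd q)) ((snd (fst q) : loop s) (snd q))))))); auto.
- apply (open_preimage F Ctvs (fun p => fst (snd p)) Q); auto.
  apply (clinear_comp F (prodtvs Ctvs Ctvs) Ctvs fst snd); [apply clinear_fst | apply clinear_snd].
- intros q [_ h]. apply h.
(* The factor [2] is a complex number with components 2 and 0, which enter the products as constant
   functions. *)
- assert (c2 : forall c : R, Cn_on n G Rtvs (fun q => loops_in Q s (fst (fst q))) (fun _ => c))
    by (intros c; apply (Cn_on_const n G Rtvs)).
  apply (Cn_on_pair n G Rtvs (prodtvs Ctvs Ctvs)); [|apply (Cn_on_pair n G Ctvs Ctvs)].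
  + apply (Cn_on_time_change n s G _ (fun q => fst (fst q)) (fun q => snd q)); auto.
    * intros q [h _]. exact h.
    * now apply Cn_on_of_clinear.
    * now apply Cn_on_of_clinear.
  + apply (Cn_on_pair n G Rtvs Rtvs).
    * apply Cn_on_minus; apply Cn_on_mult; first [apply (ez true) | apply (ez false)].
    * apply Cn_on_plus; apply Cn_on_mult; first [apply (ez true) | apply (ez false)].
  + assert (re : Cn_on n G Rtvs (fun q => loops_in Q s (fst (fst q)))
      (fun q => fst (Cmult ((fst (fst q) : loop s) (snd q)) ((snd (fst q) : loop s) (snd q))))).
    { apply Cn_on_minus; apply Cn_on_mult;
        first [apply (ez true) | apply (ez false) | apply (ex true) | apply (ex false)]. }
    assert (im : Cn_on n G Rtvs (fun q => loops_in Q s (fst (fst q)))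
      (fun q => snd (Cmult ((fst (fst q) : loop s) (snd q)) ((snd (fst q) : loop s) (snd q))))).
    { apply Cn_on_plus; apply Cn_on_mult;
        first [apply (ez true) | apply (ez false) | apply (ex true) | apply (ex false)]. }
    apply (Cn_on_pair n G Rtvs Rtvs).
    * apply Cn_on_minus; apply Cn_on_mult; auto; apply c2.
    * apply Cn_on_plus; apply Cn_on_mult; auto; apply c2.
Qed.

Lemma time_change_opp (s : bool) (z : loop_tvs s) (t : R) :
  time_change (opp z : loop s) t = time_change (z : loop s) t.
Proof.
unfold time_change, L2norm, inner. f_equal; [f_equal; f_equal; f_equal|];
  apply RInt_ext; intros u _; rewrite opp_loop_eval.
- simpl. unfold Re, Im. ring.
- now rewrite Cmod_opp.
Qed.

Lemma is_one_form_Theta (Q : C -> Prop) (theta : R -> C -> C -> R) :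
  open Q -> periodic_family Q theta -> is_one_form loop_tvs (loops_in Q) (Theta theta).
Proof.
intros o per s.
assert (c := fun n => Cn_on_Theta_integrand n Q theta s o per).
split; [|split].
- intros z hz a x y. unfold Theta.
  assert (i : forall x : loop_tvs s, ex_RInt (fun t => vartheta theta (time_change (z : loop s) t) ((z : loop s) t) ((x : loop s) t)) 0 1).
  { intros w. exact (ex_RInt_slice 0 (prodtvs (loop_tvs s) (loop_tvs s)) (fun p => loops_in Q s (fst p))
      (Theta_integrand theta s) (z, w) 0 1 (c 0%nat) hz). }
  rewrite <- RInt_linear by apply i.
  apply RInt_ext. intros t _. destruct per as [lin _].
  etransitivity; [|apply (lin _ _ (proj2 hz t))].
  unfold vartheta. f_equal.
  apply injective_projections; simpl; unfold Re, Im, scal, plus, mult; simpl; unfold mult; simpl; ring.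
- intros n.
  apply (Cn_on_RInt n (prodtvs (loop_tvs s) (loop_tvs s)) (fun p => loops_in Q s (fst p)) (Theta_integrand theta s)).
  + auto using good_prodtvs, good_loop.
  + now apply open_fst, open_loops_in.
  + apply c.
(* Under the involution the time change and [z * z] are unchanged, and the two signs in [z * xi]
   cancel. *)
- intros z X hz. apply RInt_ext. intros t _. rewrite time_change_opp.
  unfold vartheta. f_equal.
  + rewrite opp_loop_eval. ring.
  + rewrite !opp_loop_eval. ring.
Qed.

(** * The canonical one-form and pullbacks to the cotangent bundle *)

Lemma good_cotangent (s : bool) : good (cotangent_tvs s).
Proof. apply good_prodtvs; apply good_loop. Qed.

Lemma open_cotangent_in (Q : C -> Prop) (s : bool) : open Q -> open (cotangent_in Q s).
Proof. intros o. now apply open_fst, open_loops_in. Qed.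

Lemma is_one_form_Lambda (Q : C -> Prop) :
  open Q -> is_one_form cotangent_tvs (cotangent_in Q) Lambda.
Proof.
intros o s. split; [|split].
- intros p _ a X Y. apply linear_form_inner.
- intros n.
  apply (Cn_on_inner n s (prodtvs (cotangent_tvs s) (cotangent_tvs s)) _ (fun p => snd (fst p)) (fun p => fst (snd p))).
  + apply good_prodtvs; apply good_cotangent.
  + now apply open_fst, open_cotangent_in.
  + apply Cn_on_of_clinear.
    apply (clinear_comp _ (cotangent_tvs s) _ snd fst); [apply clinear_snd | apply clinear_fst].
  + apply Cn_on_of_clinear.
    apply (clinear_comp _ (cotangent_tvs s) _ fst snd); [apply clinear_fst | apply clinear_snd].
- intros p X _. apply RInt_ext. intros t _.
  change (snd (opp p)) with (opp (snd p)). change (fst (opp X)) with (opp (fst X)).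
  rewrite !opp_loop_eval. simpl. unfold Re, Im. ring.
Qed.

(** With [P] fixed, [Lambda] is linear in the momentum and independent of the base loop, hence
    affine along lines. *)
Lemma dd_Lambda (s : bool) (p P V : cotangent_tvs s) :
  dd _ (fun q => Lambda s q P) (p, V) = inner (snd V : loop s) (fst P : loop s).
Proof.
apply is_derive_unique.
apply (is_derive_ext (fun h : R => h * inner (snd V : loop s) (fst P : loop s) + inner (snd p : loop s) (fst P : loop s))).
- intros h. unfold Lambda.
  rewrite (inner_comm (snd V : loop s)), (inner_comm (snd p : loop s)).
  rewrite <- (linear_form_inner s (fst P) h (snd V) (snd p)).
  rewrite inner_comm. rewrite plus_comm. reflexivity.
- apply is_derive_affine.
Qed.

Lemma ext_Lambda (s : bool) (p X Y : cotangent_tvs s) :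
  ext_derivative _ (Lambda s) p X Y =
  inner (snd X : loop s) (fst Y : loop s) - inner (snd Y : loop s) (fst X : loop s).
Proof. unfold ext_derivative. now rewrite !dd_uncurry_base, !dd_Lambda. Qed.

Lemma is_one_form_add_pullback (U : forall s, loop_tvs s -> Prop) (lam : one_form cotangent_tvs) (mu : one_form loop_tvs) :
  is_one_form cotangent_tvs (fun s p => U s (fst p)) lam -> is_one_form loop_tvs U mu ->
  is_one_form cotangent_tvs (fun s p => U s (fst p)) (add_one cotangent_tvs lam (pullback_one mu)).
Proof.
intros hl hm s. destruct (hl s) as [l1 [l2 l3]], (hm s) as [m1 [m2 m3]].
unfold add_one, pullback_one. split; [|split].
- intros x u a X Y. rewrite (l1 x u a X Y).
  assert (k := m1 (fst x) u a (fst X) (fst Y)).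
  change (fst (plus (scal a X) Y)) with (plus (scal a (fst X)) (fst Y)). rewrite k. ring.
- intros n. apply Cn_on_plus; [apply l2|].
  apply (Cn_on_clinear n (prodtvs (cotangent_tvs s) (cotangent_tvs s)) (prodtvs (loop_tvs s) (loop_tvs s)) Rtvs
    (fun p => (fst (fst p), fst (snd p))) (fun p => U s (fst p)) (fun p => mu s (fst p) (snd p))); [|apply m2].
  apply clinear_pair.
  + apply (clinear_comp _ (cotangent_tvs s) _ fst fst); apply clinear_fst.
  + apply (clinear_comp _ (cotangent_tvs s) _ fst snd); [apply clinear_fst | apply clinear_snd].
- intros x X u. rewrite l3 by exact u. f_equal. apply m3. exact u.
Qed.

(** Naturality of the exterior derivative under a linear projection: along a line upstairs, the
    pulled-back form sees only the projected line. *)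
Lemma ext_add_pullback (U : forall s, loop_tvs s -> Prop) (lam : one_form cotangent_tvs) (mu : one_form loop_tvs)
    (s : bool) (p X Y : cotangent_tvs s) :
  (forall s, open (U s)) ->
  is_one_form cotangent_tvs (fun s p => U s (fst p)) lam -> is_one_form loop_tvs U mu ->
  U s (fst p) ->
  ext_derivative _ (add_one cotangent_tvs lam (pullback_one mu) s) p X Y =
  ext_derivative _ (lam s) p X Y + ext_derivative _ (mu s) (fst p) (fst X) (fst Y).
Proof.
intros o hl hm u. destruct (hl s) as [_ [l2 _]], (hm s) as [_ [m2 _]].
unfold ext_derivative. rewrite !dd_uncurry_base.
assert (k : forall P V, dd _ (fun q => add_one cotangent_tvs lam (pullback_one mu) s q P) (p, V) =
  dd _ (fun q => lam s q P) (p, V) + dd _ (fun y => mu s y (fst P)) (fst p, fst V)).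
{ intros P V. apply is_dderive_dd, is_dderive_plus.
  - apply (Cn_on_is_dderive 0 (cotangent_tvs s) (fun p => U s (fst p))); auto.
    apply (Cn_on_slice 1 (cotangent_tvs s) (cotangent_tvs s) (fun p => U s (fst p)) (uncurry _ _ (lam s)));
      auto using good_cotangent.
    now apply open_fst.
  - apply (is_dderive_clinear (cotangent_tvs s) (loop_tvs s) Rtvs fst (fun y => mu s y (fst P))).
    + apply clinear_fst.
    + apply (Cn_on_is_dderive 0 (loop_tvs s) (U s)); auto.
      apply (Cn_on_slice 1 (loop_tvs s) (loop_tvs s) (U s) (uncurry _ _ (mu s)));
      auto using good_loop. }
rewrite !k. ring.
Qed.

Theorem lemma5p7 :
  forall (Q : C -> Prop) (theta : R -> C -> C -> R),
    open Q -> Q 0 -> periodic_family Q theta ->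
    let B := loops_in Q in
    let M := cotangent_in Q in
    is_one_form cotangent_tvs M Lambda /\
    is_one_form loop_tvs B (Theta theta) /\
    (exists Omega, is_ext_derivative cotangent_tvs M Lambda Omega) /\
    (exists dTheta, is_ext_derivative loop_tvs B (Theta theta) dTheta) /\
    (forall (Omega : two_form cotangent_tvs) (dTheta : two_form loop_tvs),
       is_ext_derivative cotangent_tvs M Lambda Omega ->
       is_ext_derivative loop_tvs B (Theta theta) dTheta ->
       let OmegaTheta := add_two cotangent_tvs Omega (pullback_two dTheta) in
       weak_symplectic cotangent_tvs M Omega /\
       is_ext_derivative cotangent_tvs M
         (add_one cotangent_tvs Lambda (pullback_one (Theta theta))) OmegaTheta /\
       weak_symplectic cotangent_tvs M OmegaTheta).
Proof.
intros Q theta o _ per B M.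
assert (fL : is_one_form cotangent_tvs M Lambda) by now apply is_one_form_Lambda.
assert (fT : is_one_form loop_tvs B (Theta theta)) by now apply is_one_form_Theta.
assert (oB : forall s, open (B s)) by (intros s; now apply open_loops_in).
assert (oM : forall s, open (M s)) by (intros s; now apply open_cotangent_in).
assert (sM : forall s (x : cotangent_tvs s), M s x -> M s (opp x)) by (intros s x; apply loops_in_opp).
assert (gM := good_cotangent). assert (gB := good_loop).
split; [exact fL|]. split; [exact fT|].
split; [eexists; exact (is_ext_derivative_ext _ M gM oM _ fL)|].
split; [eexists; exact (is_ext_derivative_ext _ B gB oB _ fT)|].
intros Omega dTheta hO hT OT.
assert (eO := proj1 (is_ext_derivative_iff _ M gM oM _ _ fL) hO).
assert (eT := proj1 (is_ext_derivative_iff _ B gB oB _ _ fT) hT).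
assert (fA : is_one_form cotangent_tvs M (add_one cotangent_tvs Lambda (pullback_one (Theta theta))))
  by exact (is_one_form_add_pullback B _ _ fL fT).
assert (hOT : is_ext_derivative cotangent_tvs M (add_one cotangent_tvs Lambda (pullback_one (Theta theta))) OT).
{ apply (is_ext_derivative_iff _ M gM oM _ _ fA). intros s p X Y u.
  rewrite (ext_add_pullback B _ _ s p X Y oB fL fT u).
  unfold OT, add_two, pullback_two. now rewrite eO, eT. }
assert (tT := is_two_form_ext_derivative _ B gB oB (loops_in_opp Q) _ _ fT hT).
(* One test vector serves both forms: it annihilates the magnetic term, so [Omega] and [OT] take the
   same nonzero value on it. *)
assert (nd : forall s (x X : cotangent_tvs s), M s x -> X <> zero ->
  exists Y : cotangent_tvs s, Omega s x X Y <> 0 /\ OT s x X Y <> 0).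
{ intros s x X u nz.
  destruct (tT s) as [linX [linY _]].
  destruct (classic (fst X = zero)) as [e|ne].
  - assert (ne : snd X <> zero).
    { intros e'. apply nz. now apply injective_projections. }
    assert (p := inner_pos s (snd X) ne).
    assert (k : Omega s x X (snd X, zero) = inner (snd X : loop s) (snd X : loop s)).
    { rewrite eO, ext_Lambda by assumption.
      assert (k0 := linear_form_zero _ _ (linear_form_inner s (fst X))).
      cbv beta in k0. rewrite inner_comm in k0.
      etransitivity; [exact (f_equal (Rminus _) k0)|]. apply Rminus_0_r. }
    exists (snd X, zero). unfold OT, add_two, pullback_two. rewrite k, e.
    rewrite (linear_form_zero _ _ (linX (fst x) _ u)). lra.
  - assert (p := inner_pos s (fst X) ne).
    assert (k : Omega s x X (zero, fst X) = - inner (fst X : loop s) (fst X : loop s)).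
    { rewrite eO, ext_Lambda by assumption.
      assert (k0 := linear_form_zero _ _ (linear_form_inner s (snd X))). cbv beta in k0.
      etransitivity; [exact (f_equal (fun r => r - _) k0)|]. apply Rminus_0_l. }
    exists (zero, fst X). unfold OT, add_two, pullback_two. rewrite k.
    assert (k' : dTheta s (fst x) (fst X) zero = 0)
      by exact (linear_form_zero _ _ (linY (fst x) (fst X) u)).
    change (fst (zero, fst X)) with (zero : loop_tvs s). rewrite k'. lra. }
split; [|split; [exact hOT|]].
- split; [|split].
  + exact (is_two_form_ext_derivative _ M gM oM sM _ _ fL hO).
  + exact (is_closed_ext_derivative _ M gM oM sM _ _ fL hO).
  + intros s x X u nz. destruct (nd s x X u nz) as [Y [h _]]. now exists Y.
- split; [|split].
  + exact (is_two_form_ext_derivative _ M gM oM sM _ _ fA hOT).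
  + exact (is_closed_ext_derivative _ M gM oM sM _ _ fA hOT).
  + intros s x X u nz. destruct (nd s x X u nz) as [Y [_ h]]. now exists Y.
Qed.
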